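(* Any space-like Weingarten surface in $\mathbb R^3_1$ admits locally natural principal parameters.
   Context: $\mathbb R^3_1$ is three-dimensional Minkowski space with flat metric of signature $(2,1)$. All functions are assumed smooth. A surface $z=z(u,v)$, $(u,v)\in\mathcal D$ ($\mathcal D\subset\mathbb R^2$ a domain), is space-like if its induced metric is positive definite; its unit normal $l$ satisfies $l^2=-1$. Put $E=z_u^2$, $F=z_uz_v$, $G=z_v^2$, $L=lz_{uu}$, $M=lz_{uv}$, $N=lz_{vv}$. Surfaces are free of umbilical points; $(u,v)$ are principal parameters if $F=M=0$, and then the principal curvatures are $\nu_1=L/E$, $\nu_2=N/G$. A space-like surface is a (space-like) Weingarten surface, or W-surface, if there exist differentiable functions $f,g$ of one variable, defined on an interval $\mathcal I\subseteq\mathbb R$, and a differentiable function $\nu=\nu(u,v)\in\mathcal I$ on $\mathcal D$ such that $f'g'\neq0$, $f-g\neq0$, and $\nu_1=f(\nu)$, $\nu_2=g(\nu)$ at every point. For a fixed $\nu_0\in\mathcal I$ put $$I=\int_{\nu_0}^{\nu}\frac{f'(\nu)\,d\nu}{f(\nu)-g(\nu)},\qquad J=\int_{\nu_0}^{\nu}\frac{g'(\nu)\,d\nu}{g(\nu)-f(\nu)}.$$ Principal parameters $(u,v)$ on a space-like W-surface are called natural principal if the functions $\lambda=\sqrt E\,e^{I}$ and $\mu=\sqrt G\,e^{J}$ are both constant. (In general, for principal parameters, $\lambda$ does not depend on $v$ and $\mu$ does not depend on $u$.) *)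

(* Defs.v *)
From Stdlib Require Import Reals.
From Coquelicot Require Import Coquelicot.
Open Scope R_scope.

(** Minkowski space with the flat metric of signature (2,1). *)
Definition R31 : Type := (R * R * R)%type.
Definition x1 (p : R31) : R := fst (fst p).
Definition x2 (p : R31) : R := snd (fst p).
Definition x3 (p : R31) : R := snd p.
Definition mink (p q : R31) : R := x1 p * x1 q + x2 p * x2 q - x3 p * x3 q.

(** Nonempty connected open subsets of the plane. *)
Definition is_domain (D : R * R -> Prop) : Prop :=
  open D /\ (exists p, D p) /\
  (forall A B : R * R -> Prop, open A -> open B ->
     (forall p, D p -> A p \/ B p) ->
     (exists p, D p /\ A p) -> (exists p, D p /\ B p) ->
     exists p, D p /\ A p /\ B p).

Definition du (h : R -> R -> R) (u v : R) : R := Derive (fun t => h t v) u.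
Definition dv (h : R -> R -> R) (u v : R) : R := Derive (fun t => h u t) v.
Definition du3 (w : R -> R -> R31) (u v : R) : R31 :=
  (du (fun s t => x1 (w s t)) u v, du (fun s t => x2 (w s t)) u v,
   du (fun s t => x3 (w s t)) u v).
Definition dv3 (w : R -> R -> R31) (u v : R) : R31 :=
  (dv (fun s t => x1 (w s t)) u v, dv (fun s t => x2 (w s t)) u v,
   dv (fun s t => x3 (w s t)) u v).

(** C^oo on a set that is meant to be open: [ex_diff_n h n u v] says that all
    iterated partial derivatives of order at most [n] exist and are continuous
    at [(u, v)]. *)
Definition smooth2 (D : R * R -> Prop) (h : R -> R -> R) : Prop :=
  forall u v, D (u, v) -> forall n, ex_diff_n h n u v.
Definition smooth2_R2 (D : R * R -> Prop) (w : R -> R -> R * R) : Prop :=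
  smooth2 D (fun u v => fst (w u v)) /\ smooth2 D (fun u v => snd (w u v)).
Definition smooth2_R31 (D : R * R -> Prop) (w : R -> R -> R31) : Prop :=
  smooth2 D (fun u v => x1 (w u v)) /\ smooth2 D (fun u v => x2 (w u v)) /\
  smooth2 D (fun u v => x3 (w u v)).

(** One-variable smoothness on an interval, which may contain its endpoints:
    as usual on sets that need not be open, it means C^oo on a neighbourhood,
    so that derivatives at an endpoint are those of the extension. *)
Definition smooth1 (K : R -> Prop) (h : R -> R) : Prop :=
  forall x, K x -> locally x (fun y => forall n, ex_derive_n h n y).

(** A parametrized surface [pos] on [dom] with a choice of unit normal [nrm]. *)
Record surface : Type := Surface {
  dom : R * R -> Prop;
  pos : R -> R -> R31;
  nrm : R -> R -> R31
}.

Section FundamentalForms.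
Variables (S : surface) (u v : R).
Definition cE : R := mink (du3 (pos S) u v) (du3 (pos S) u v).
Definition cF : R := mink (du3 (pos S) u v) (dv3 (pos S) u v).
Definition cG : R := mink (dv3 (pos S) u v) (dv3 (pos S) u v).
Definition cL : R := mink (nrm S u v) (du3 (du3 (pos S)) u v).
Definition cM : R := mink (nrm S u v) (dv3 (du3 (pos S)) u v).
Definition cN : R := mink (nrm S u v) (dv3 (dv3 (pos S)) u v).

(** [a z_u + b z_v] is an eigenvector of the shape operator with eigenvalue
    [k], the shape operator being the endomorphism that represents the second
    fundamental form with respect to the first. *)
Definition principal_direction (k a b : R) : Prop :=
  cL * a + cM * b = k * (cE * a + cF * b) /\
  cM * a + cN * b = k * (cF * a + cG * b).

Definition principal_curvatures (k1 k2 : R) : Prop :=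
  exists a1 b1 a2 b2 : R,
    a1 * b2 - a2 * b1 <> 0 /\
    principal_direction k1 a1 b1 /\ principal_direction k2 a2 b2.

Definition umbilical : Prop :=
  exists k : R, cL = k * cE /\ cM = k * cF /\ cN = k * cG.
End FundamentalForms.

Definition spacelike_surface (S : surface) : Prop :=
  is_domain (dom S) /\
  smooth2_R31 (dom S) (pos S) /\ smooth2_R31 (dom S) (nrm S) /\
  (forall u v, dom S (u, v) ->
     (forall a b, (a, b) <> (0, 0) ->
        0 < cE S u v * a ^ 2 + 2 * cF S u v * a * b + cG S u v * b ^ 2) /\
     mink (nrm S u v) (nrm S u v) = -1 /\
     mink (nrm S u v) (du3 (pos S) u v) = 0 /\
     mink (nrm S u v) (dv3 (pos S) u v) = 0 /\
     ~ umbilical S u v).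

(** [S] is a space-like Weingarten surface, with [f], [g], [nu] as witnesses;
    the parameters of [S] need not be principal. *)
Definition weingarten (S : surface) (K : R -> Prop) (f g : R -> R)
    (nu : R -> R -> R) : Prop :=
  spacelike_surface S /\
  is_connected K /\ smooth1 K f /\ smooth1 K g /\ smooth2 (dom S) nu /\
  (forall t, K t -> Derive f t * Derive g t <> 0 /\ f t - g t <> 0) /\
  (forall u v, dom S (u, v) ->
     K (nu u v) /\ principal_curvatures S u v (f (nu u v)) (g (nu u v))).

Definition int_I (f g : R -> R) (nu0 x : R) : R :=
  RInt (fun t => Derive f t / (f t - g t)) nu0 x.
Definition int_J (f g : R -> R) (nu0 x : R) : R :=
  RInt (fun t => Derive g t / (g t - f t)) nu0 x.

Definition principal_parameters (S : surface) : Prop :=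
  forall u v, dom S (u, v) -> cF S u v = 0 /\ cM S u v = 0.

(** The parameters of [S] are principal, numbered so that [nu_1 = L/E = f(nu)]
    and [nu_2 = N/G = g(nu)], and the functions lambda and mu are constant. *)
Definition natural_principal (S : surface) (f g : R -> R)
    (nu : R -> R -> R) (nu0 : R) : Prop :=
  principal_parameters S /\
  (forall u v, dom S (u, v) ->
     cL S u v / cE S u v = f (nu u v) /\ cN S u v / cG S u v = g (nu u v)) /\
  (exists lambda : R, forall u v, dom S (u, v) ->
     sqrt (cE S u v) * exp (int_I f g nu0 (nu u v)) = lambda) /\
  (exists mu : R, forall u v, dom S (u, v) ->
     sqrt (cG S u v) * exp (int_J f g nu0 (nu u v)) = mu).

(** [phi] is a C^oo diffeomorphism from the open set [V] onto the open set [U]. *)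
Definition diffeo (V U : R * R -> Prop) (phi : R -> R -> R * R) : Prop :=
  open V /\ open U /\ smooth2_R2 V phi /\
  (forall u v, V (u, v) -> U (phi u v)) /\
  exists psi : R -> R -> R * R,
    smooth2_R2 U psi /\
    (forall x y, U (x, y) -> V (psi x y)) /\
    (forall u v, V (u, v) -> psi (fst (phi u v)) (snd (phi u v)) = (u, v)) /\
    (forall x y, U (x, y) -> phi (fst (psi x y)) (snd (psi x y)) = (x, y)).

Definition pullback {T : Type} (h : R -> R -> T) (phi : R -> R -> R * R)
    (u v : R) : T :=
  h (fst (phi u v)) (snd (phi u v)).

Definition reparametrize (S : surface) (V : R * R -> Prop)
    (phi : R -> R -> R * R) : surface :=
  Surface V (pullback (pos S) phi) (pullback (nrm S) phi).

(* Main.v *)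
Require Import Defs.
From Stdlib Require Import Reals Lra Lia ClassicalEpsilon.
From Coquelicot Require Import Coquelicot.
Open Scope R_scope.

(** Let [X1], [X2] be the unit principal directions for [f(nu)], [g(nu)], and
    [theta1], [theta2] the dual coframe.  Natural principal parameters are
    functions [s], [t] with [ds = exp(I) theta1] and [dt = exp(J) theta2], up to
    constant factors; so, once both forms are known to be closed, they exist by
    the Poincare lemma, and they are local parameters by the inverse function
    theorem.  The given parameters need not be principal, and no differential
    equation has to be solved.

    The closedness is the Codazzi equation, in the following form.  Write [z]
    for the position vector, [l] for the normal and [dz = theta1 e1 + theta2 e2].
    Since [dl = - f theta1 e1 - g theta2 e2], the vector-valued form [dl + f dz]
    is orthogonal to [e1], and [dl + g dz] is parallel to [e1].  The exterior
    derivative of [(dl + f dz) . e1 = 0] then gives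
    [d theta1 = - df / (f - g) /\ theta1 = - dI /\ theta1], that is
    [d (exp(I) theta1) = 0] ([Codazzi_closed]).  Exchanging [f] and [g] turns [I]
    into [J] and gives the second form.

    The frame is obtained without solving for eigenvectors.  At each point the two
    values of [dl + g dz] on the coordinate vectors span the first principal line
    ([principal_lines]); near the given point one of them does not vanish, and
    normalizing it gives a smooth [e1] ([smooth_unit_vector]).  The field [e2]
    comes from [dl + f dz] in the same way.

    In the new parameters [z_u = exp(-I) e1], [z_v = exp(-J) e2],
    [l_u = - f z_u] and [l_v = - g z_v], so that [F = M = 0], [L / E = f],
    [N / G = g] and [lambda = mu = 1] ([frame_parameters]).

    The analytic part is the calculus of smooth functions of two variables on
    open sets, the Poincare lemma on squares ([Poincare_square]) and the inverse
    function theorem ([inverse_function]), which rests on Banach's fixed point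
    theorem for the maximum norm of the plane. *)

(** * Smooth functions of two variables *)

(** [hx] and [hy] are the partial derivatives of [h] on [D]. *)
Definition partials (D : R * R -> Prop) (h hx hy : R -> R -> R) : Prop :=
  forall x y, D (x, y) ->
    is_derive (fun t => h t y) x (hx x y) /\
    is_derive (fun t => h x t) y (hy x y).

(** [h] is of class C^n on [D].  The partial derivatives are given by witnesses
    instead of [Derive], so that they need to be known only on [D]; this makes the
    closure properties direct inductions on [n]. *)
Fixpoint Ck (n : nat) (D : R * R -> Prop) (h : R -> R -> R) : Prop :=
  (forall x y : R, D (x, y) -> continuity_2d_pt h x y) /\
  match n with
  | O => True
  | S m => exists hx hy, partials D h hx hy /\ Ck m D hx /\ Ck m D hy
  end.

Lemma open_locally_2d (D : R * R -> Prop) x y :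
  open D -> D (x, y) -> locally_2d (fun u v => D (u, v)) x y.
Proof.
  intros HD Hxy. destruct (HD (x, y) Hxy) as [d Hd].
  exists d. intros u v Hu Hv. apply Hd. split; assumption.
Qed.

Lemma open_slice1 (D : R * R -> Prop) x y : open D -> D (x, y) -> locally x (fun t => D (t, y)).
Proof.
  intros HD Hxy. destruct (HD (x, y) Hxy) as [d Hd].
  exists d. intros t Ht. apply Hd. split; [assumption | apply ball_center].
Qed.

Lemma open_slice2 (D : R * R -> Prop) x y : open D -> D (x, y) -> locally y (fun t => D (x, t)).
Proof.
  intros HD Hxy. destruct (HD (x, y) Hxy) as [d Hd].
  exists d. intros t Ht. apply Hd. split; [apply ball_center | assumption].
Qed.

Lemma partials_ext (D : R * R -> Prop) h k hx hy :
  open D -> (forall x y : R, D (x, y) -> h x y = k x y) ->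
  partials D h hx hy -> partials D k hx hy.
Proof.
  intros HD He Hp x y Hxy. destruct (Hp x y Hxy) as [H1 H2]. split.
  - apply is_derive_ext_loc with (2 := H1).
    apply filter_imp with (2 := open_slice1 D x y HD Hxy). intros t Ht; apply He, Ht.
  - apply is_derive_ext_loc with (2 := H2).
    apply filter_imp with (2 := open_slice2 D x y HD Hxy). intros t Ht; apply He, Ht.
Qed.

Lemma Ck_cont n (D : R * R -> Prop) h : Ck n D h -> forall x y, D (x, y) -> continuity_2d_pt h x y.
Proof. destruct n; intros H; apply H. Qed.

Lemma Ck_ext n (D : R * R -> Prop) h k :
  open D -> (forall x y : R, D (x, y) -> h x y = k x y) -> Ck n D h -> Ck n D k.
Proof.
  intros HD He Hh.
  assert (Hc : forall x y, D (x, y) -> continuity_2d_pt k x y).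
  { intros x y Hxy. apply continuity_2d_pt_ext_loc with (2 := Ck_cont n D h Hh x y Hxy).
    destruct (open_locally_2d D x y HD Hxy) as [d Hd].
    exists d. intros u v Hu Hv. apply He, Hd; assumption. }
  destruct n as [|n]; split; auto.
  destruct Hh as [_ (hx & hy & Hp & Hx & Hy)].
  exists hx, hy. split; auto. apply partials_ext with h; assumption.
Qed.

Lemma Ck_pred n (D : R * R -> Prop) h : Ck (S n) D h -> Ck n D h.
Proof.
  revert h. induction n as [|n IH]; intros h Hh.
  - split; [apply Hh | exact I].
  - split; [apply Hh|]. destruct Hh as [_ (hx & hy & Hp & Hx & Hy)].
    exists hx, hy. auto.
Qed.

(** A function with continuous partial derivatives is differentiable. *)
Lemma partials_differentiable (D : R * R -> Prop) h hx hy x y :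
  open D -> partials D h hx hy -> Ck 0 D hx -> D (x, y) ->
  differentiable_pt_lim h x y (hx x y) (hy x y).
Proof.
  intros HD Hp [Hc _] Hxy.
  apply filterdiff_differentiable_pt_lim.
  apply (is_derive_filterdiff h x y hx (hy x y)).
  - apply filter_imp with (2 := HD (x, y) Hxy). intros [a b] Hab. apply (Hp a b Hab).
  - apply Hp, Hxy.
  - apply continuity_2d_pt_filterlim, Hc, Hxy.
Qed.

Lemma partials_continuity (D : R * R -> Prop) h hx hy x y :
  open D -> partials D h hx hy -> Ck 0 D hx -> D (x, y) ->
  continuity_2d_pt h x y.
Proof.
  intros HD Hp Hc Hxy. apply differentiable_continuity_pt.
  exists (hx x y), (hy x y). eapply partials_differentiable; eassumption.
Qed.

Lemma Ck_intro n (D : R * R -> Prop) h hx hy :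
  open D -> partials D h hx hy -> Ck n D hx -> Ck n D hy -> Ck (S n) D h.
Proof.
  intros HD Hp Hx Hy. split.
  - intros x y Hxy. apply partials_continuity with D hx hy; auto.
    split; [apply (Ck_cont n D), Hx | exact I].
  - exists hx, hy. auto.
Qed.

Lemma Ck_ex_diff_n n (D : R * R -> Prop) h :
  open D -> Ck n D h -> forall x y, D (x, y) -> ex_diff_n h n x y.
Proof.
  intros HD. revert h. induction n as [|n IH]; intros h [Hc Hh] x y Hxy.
  - split; auto.
  - destruct Hh as (hx & hy & Hp & Hx & Hy).
    split; [auto|]. destruct (Hp x y Hxy) as [H1 H2].
    split; [eexists; exact H1|]. split; [eexists; exact H2|].
    destruct (open_locally_2d D x y HD Hxy) as [d Hd].
    split.
    + apply ex_diff_n_ext_loc with (2 := IH hx Hx x y Hxy).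
      exists d. intros u v Hu Hv. symmetry. apply is_derive_unique.
      apply Hp, Hd; assumption.
    + apply ex_diff_n_ext_loc with (2 := IH hy Hy x y Hxy).
      exists d. intros u v Hu Hv. symmetry. apply is_derive_unique.
      apply Hp, Hd; assumption.
Qed.

Lemma ex_diff_n_Ck n (D : R * R -> Prop) h :
  (forall x y : R, D (x, y) -> ex_diff_n h n x y) -> Ck n D h.
Proof.
  revert h. induction n as [|n IH]; intros h Hh.
  - split; [|exact I]. intros x y Hxy. apply (Hh x y Hxy).
  - split; [intros x y Hxy; apply (Hh x y Hxy)|].
    exists (du h), (dv h). split; [|split].
    + intros x y Hxy. destruct (Hh x y Hxy) as (_ & H1 & H2 & _).
      split; apply Derive_correct; assumption.
    + apply IH. intros x y Hxy. apply (Hh x y Hxy).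
    + apply IH. intros x y Hxy. apply (Hh x y Hxy).
Qed.

(** On an open set, [smooth2] is membership in every class C^n. *)
Lemma smooth2_Ck (D : R * R -> Prop) h : open D -> (smooth2 D h <-> forall n, Ck n D h).
Proof.
  intros HD. split.
  - intros H n. apply ex_diff_n_Ck. intros x y Hxy. apply H, Hxy.
  - intros H x y Hxy n. apply Ck_ex_diff_n with D; auto.
Qed.

Lemma Ck_const n (D : R * R -> Prop) c : open D -> Ck n D (fun _ _ => c).
Proof.
  intros HD. revert c. induction n as [|n IH]; intros c.
  - split; [|exact I]. intros; apply continuity_2d_pt_const.
  - apply Ck_intro with (fun _ _ => 0) (fun _ _ => 0); auto.
    intros x y _. split; auto_derive; auto.
Qed.

Lemma partials_plus (D : R * R -> Prop) h hx hy k kx ky :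
  partials D h hx hy -> partials D k kx ky ->
  partials D (fun x y => h x y + k x y) (fun x y => hx x y + kx x y)
    (fun x y => hy x y + ky x y).
Proof.
  intros Hp Kp x y Hxy. destruct (Hp x y Hxy), (Kp x y Hxy).
  split; apply @is_derive_plus; auto.
Qed.

Lemma partials_mult (D : R * R -> Prop) h hx hy k kx ky :
  partials D h hx hy -> partials D k kx ky ->
  partials D (fun x y => h x y * k x y) (fun x y => hx x y * k x y + h x y * kx x y)
    (fun x y => hy x y * k x y + h x y * ky x y).
Proof.
  intros Hp Kp x y Hxy. destruct (Hp x y Hxy), (Kp x y Hxy). split.
  - apply (is_derive_mult (fun t => h t y) (fun t => k t y)); auto. apply Rmult_comm.
  - apply (is_derive_mult (fun t => h x t) (fun t => k x t)); auto. apply Rmult_comm.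
Qed.

Lemma Ck_plus n (D : R * R -> Prop) h k :
  open D -> Ck n D h -> Ck n D k -> Ck n D (fun x y => h x y + k x y).
Proof.
  intros HD. revert h k. induction n as [|n IH]; intros h k Hh Hk.
  - split; [|exact I]. intros; apply continuity_2d_pt_plus; [apply Hh|apply Hk]; auto.
  - destruct Hh as [_ (hx & hy & Hp & Hx & Hy)], Hk as [_ (kx & ky & Kp & Kx & Ky)].
    eapply Ck_intro; [auto | apply partials_plus; eassumption | auto | auto].
Qed.

Lemma Ck_mult n (D : R * R -> Prop) h k :
  open D -> Ck n D h -> Ck n D k -> Ck n D (fun x y => h x y * k x y).
Proof.
  intros HD. revert h k. induction n as [|n IH]; intros h k Hh Hk.
  - split; [|exact I]. intros; apply continuity_2d_pt_mult; [apply Hh|apply Hk]; auto.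
  - pose proof (Ck_pred n D h Hh). pose proof (Ck_pred n D k Hk).
    destruct Hh as [_ (hx & hy & Hp & Hx & Hy)], Hk as [_ (kx & ky & Kp & Kx & Ky)].
    eapply Ck_intro; [auto | apply partials_mult; eassumption | |]; auto using Ck_plus.
Qed.

(** Composition with a function of one variable that has derivatives of every
    order [H 0, H 1, ...] on a set that contains the values of [h]. *)
Lemma Ck_comp1 n (D : R * R -> Prop) (K : R -> Prop) (H : nat -> R -> R) h :
  open D -> (forall j t, K t -> is_derive (H j) t (H (S j) t)) ->
  (forall x y : R, D (x, y) -> K (h x y)) -> Ck n D h ->
  forall j, Ck n D (fun x y => H j (h x y)).
Proof.
  intros HD HH HK. induction n as [|n IH]; intros Hh j.
  - split; [|exact I]. intros x y Hxy. apply continuity_1d_2d_pt_comp.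
    + apply derivable_continuous_pt. exists (H (S j) (h x y)).
      apply is_derive_Reals, HH, HK, Hxy.
    + apply Hh, Hxy.
  - pose proof (Ck_pred n D h Hh) as Hn. destruct Hh as [_ (hx & hy & Hp & Hx & Hy)].
    apply Ck_intro with (fun x y => hx x y * H (S j) (h x y))
       (fun x y => hy x y * H (S j) (h x y)); auto using Ck_mult.
    intros x y Hxy. destruct (Hp x y Hxy).
    split.
    + apply (is_derive_comp (H j) (fun t => h t y)); auto.
    + apply (is_derive_comp (H j) (fun t => h x t)); auto.
Qed.

Lemma Ck_exp n (D : R * R -> Prop) h : open D -> Ck n D h -> Ck n D (fun x y => exp (h x y)).
Proof.
  intros HD Hh. refine (Ck_comp1 n D (fun _ => True) (fun _ => exp) h HD _ _ Hh O); auto.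
  intros _ t _. apply is_derive_exp.
Qed.

Lemma Ck_inv n (D : R * R -> Prop) h :
  open D -> (forall x y : R, D (x, y) -> h x y <> 0) -> Ck n D h ->
  Ck n D (fun x y => / h x y).
Proof.
  intros HD H0. induction n as [|n IH]; intros Hh.
  - split; [|exact I]. intros x y Hxy. apply continuity_2d_pt_inv; auto. apply Hh, Hxy.
  - pose proof (Ck_pred n D h Hh) as Hn. destruct Hh as [_ (hx & hy & Hp & Hx & Hy)].
    apply Ck_intro with (fun x y => -1 * hx x y * (/ h x y * / h x y))
       (fun x y => -1 * hy x y * (/ h x y * / h x y)); auto using Ck_mult, Ck_const.
    intros x y Hxy. destruct (Hp x y Hxy) as [H1 H2]. pose proof (H0 x y Hxy).
    split.
    + replace (-1 * hx x y * _) with (- hx x y / h x y ^ 2) by (field; auto).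
      apply (is_derive_inv (fun t => h t y)); auto.
    + replace (-1 * hy x y * _) with (- hy x y / h x y ^ 2) by (field; auto).
      apply (is_derive_inv (fun t => h x t)); auto.
Qed.

Lemma Ck_sqrt n (D : R * R -> Prop) h :
  open D -> (forall x y : R, D (x, y) -> 0 < h x y) -> Ck n D h ->
  Ck n D (fun x y => sqrt (h x y)).
Proof.
  intros HD H0. induction n as [|n IH]; intros Hh.
  - split; [|exact I]. intros x y Hxy. apply continuity_1d_2d_pt_comp.
    + apply continuity_pt_sqrt. apply Rlt_le; auto.
    + apply Hh, Hxy.
  - pose proof (Ck_pred n D h Hh) as Hn. destruct Hh as [_ (hx & hy & Hp & Hx & Hy)].
    assert (Ck n D (fun x y => / sqrt (h x y))).
    { apply Ck_inv; auto. intros x y Hxy. apply Rgt_not_eq, sqrt_lt_R0; auto. }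
    apply Ck_intro with (fun x y => / 2 * hx x y * / sqrt (h x y))
       (fun x y => / 2 * hy x y * / sqrt (h x y)); auto using Ck_mult, Ck_const.
    intros x y Hxy. destruct (Hp x y Hxy) as [H1 H2]. pose proof (H0 x y Hxy) as Hpos.
    pose proof (sqrt_lt_R0 _ Hpos).
    split.
    + replace (/ 2 * hx x y * _) with (hx x y / (2 * sqrt (h x y))) by (field; lra).
      apply (is_derive_sqrt (fun t => h t y)); auto.
    + replace (/ 2 * hy x y * _) with (hy x y / (2 * sqrt (h x y))) by (field; lra).
      apply (is_derive_sqrt (fun t => h x t)); auto.
Qed.

Lemma continuity_2d_comp h a b u v :
  continuity_2d_pt h (a u v) (b u v) ->
  continuity_2d_pt a u v -> continuity_2d_pt b u v ->
  continuity_2d_pt (fun s t => h (a s t) (b s t)) u v.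
Proof.
  intros Hh Ha Hb eps. destruct (Hh eps) as [d Hd].
  destruct (Ha d) as [d1 H1], (Hb d) as [d2 H2].
  assert (Hm : 0 < Rmin d1 d2) by (apply Rmin_case; apply cond_pos).
  exists (mkposreal _ Hm). simpl. intros s t Hs Ht.
  pose proof (Rmin_l d1 d2). pose proof (Rmin_r d1 d2).
  apply Hd; [apply H1 | apply H2]; lra.
Qed.

(** The chain rule. *)
Lemma partials_comp (V U : R * R -> Prop) h hx hy a au av b bu bv :
  open U -> partials U h hx hy -> Ck 0 U hx ->
  partials V a au av -> partials V b bu bv ->
  (forall u v : R, V (u, v) -> U (a u v, b u v)) ->
  partials V (fun u v => h (a u v) (b u v))
    (fun u v => hx (a u v) (b u v) * au u v + hy (a u v) (b u v) * bu u v)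
    (fun u v => hx (a u v) (b u v) * av u v + hy (a u v) (b u v) * bv u v).
Proof.
  intros HU Hp Hc Ha Hb HV u v Huv.
  pose proof (partials_differentiable U h hx hy _ _ HU Hp Hc (HV u v Huv)) as Hd.
  destruct (Ha u v Huv), (Hb u v Huv).
  split; apply is_derive_Reals.
  - apply (derivable_pt_lim_comp_2d h (fun t => a t v) (fun t => b t v)); auto;
      apply is_derive_Reals; auto.
  - apply (derivable_pt_lim_comp_2d h (fun t => a u t) (fun t => b u t)); auto;
      apply is_derive_Reals; auto.
Qed.

Lemma Ck_comp n (V U : R * R -> Prop) h a b :
  open V -> open U -> (forall u v : R, V (u, v) -> U (a u v, b u v)) ->
  Ck n U h -> Ck n V a -> Ck n V b -> Ck n V (fun u v => h (a u v) (b u v)).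
Proof.
  intros HV HU HVU. revert h. induction n as [|n IH]; intros h Hh Ha Hb.
  - split; [|exact I]. intros u v Huv.
    apply continuity_2d_comp; [apply Hh | apply Ha | apply Hb]; auto.
  - pose proof (Ck_pred n V a Ha). pose proof (Ck_pred n V b Hb).
    destruct Hh as [_ (hx & hy & Hp & Hx & Hy)].
    destruct Ha as [_ (au & av & Hpa & Hau & Hav)].
    destruct Hb as [_ (bu & bv & Hpb & Hbu & Hbv)].
    eapply Ck_intro; auto.
    + eapply partials_comp; eauto. split; [apply (Ck_cont n U), Hx | exact I].
    + auto using Ck_plus, Ck_mult.
    + auto using Ck_plus, Ck_mult.
Qed.

Lemma smooth2_partials (D : R * R -> Prop) h : smooth2 D h -> partials D h (du h) (dv h).
Proof.
  intros H x y Hxy. destruct (H x y Hxy 1%nat) as (_ & H1 & H2 & _).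
  split; apply Derive_correct; assumption.
Qed.

Lemma smooth2_du (D : R * R -> Prop) h : smooth2 D h -> smooth2 D (du h).
Proof. intros H x y Hxy n. apply (H x y Hxy (S n)). Qed.

Lemma smooth2_dv (D : R * R -> Prop) h : smooth2 D h -> smooth2 D (dv h).
Proof. intros H x y Hxy n. apply (H x y Hxy (S n)). Qed.

Lemma partials_du (D : R * R -> Prop) h hx hy x y : partials D h hx hy -> D (x, y) -> du h x y = hx x y.
Proof. intros H Hxy. apply is_derive_unique, H, Hxy. Qed.

Lemma partials_dv (D : R * R -> Prop) h hx hy x y : partials D h hx hy -> D (x, y) -> dv h x y = hy x y.
Proof. intros H Hxy. apply is_derive_unique, H, Hxy. Qed.

(** A function with smooth partial derivatives is smooth. *)
Lemma smooth2_intro (D : R * R -> Prop) h hx hy :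
  open D -> partials D h hx hy -> smooth2 D hx -> smooth2 D hy -> smooth2 D h.
Proof.
  intros HD Hp Hx Hy. apply smooth2_Ck; auto. intros n. apply Ck_pred.
  apply Ck_intro with hx hy; auto; apply smooth2_Ck; auto.
Qed.

Lemma smooth2_restrict (D D' : R * R -> Prop) h :
  (forall q, D' q -> D q) -> smooth2 D h -> smooth2 D' h.
Proof. intros HD H u v Huv. apply H, HD, Huv. Qed.

Lemma smooth2_cont (D : R * R -> Prop) h x y : smooth2 D h -> D (x, y) -> continuity_2d_pt h x y.
Proof. intros H Hxy. apply (H x y Hxy O). Qed.

Lemma smooth2_const (D : R * R -> Prop) c : open D -> smooth2 D (fun _ _ => c).
Proof. intros HD. apply smooth2_Ck; auto. intros; apply Ck_const; auto. Qed.

Lemma smooth2_plus (D : R * R -> Prop) h k :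
  open D -> smooth2 D h -> smooth2 D k -> smooth2 D (fun x y => h x y + k x y).
Proof.
  intros HD Hh Hk. apply smooth2_Ck; auto. intros; apply Ck_plus; auto;
  apply smooth2_Ck; auto.
Qed.

Lemma smooth2_mult (D : R * R -> Prop) h k :
  open D -> smooth2 D h -> smooth2 D k -> smooth2 D (fun x y => h x y * k x y).
Proof.
  intros HD Hh Hk. apply smooth2_Ck; auto. intros; apply Ck_mult; auto;
  apply smooth2_Ck; auto.
Qed.

Lemma smooth2_ext (D : R * R -> Prop) h k :
  open D -> (forall x y : R, D (x, y) -> h x y = k x y) -> smooth2 D h -> smooth2 D k.
Proof.
  intros HD He Hh. apply smooth2_Ck; auto. intros n. apply Ck_ext with h; auto.
  apply smooth2_Ck; auto.
Qed.

Lemma smooth2_minus (D : R * R -> Prop) h k :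
  open D -> smooth2 D h -> smooth2 D k -> smooth2 D (fun x y => h x y - k x y).
Proof.
  intros HD Hh Hk. apply smooth2_ext with (fun x y => h x y + -1 * k x y); auto.
  - intros; ring.
  - auto using smooth2_plus, smooth2_mult, smooth2_const.
Qed.

Lemma smooth2_inv (D : R * R -> Prop) h :
  open D -> (forall x y : R, D (x, y) -> h x y <> 0) -> smooth2 D h ->
  smooth2 D (fun x y => / h x y).
Proof.
  intros HD H0 Hh. apply smooth2_Ck; auto. intros n. apply Ck_inv; auto.
  apply smooth2_Ck; auto.
Qed.

Lemma smooth2_sqrt (D : R * R -> Prop) h :
  open D -> (forall x y : R, D (x, y) -> 0 < h x y) -> smooth2 D h ->
  smooth2 D (fun x y => sqrt (h x y)).
Proof.
  intros HD H0 Hh. apply smooth2_Ck; auto. intros n. apply Ck_sqrt; auto.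
  apply smooth2_Ck; auto.
Qed.

Lemma smooth2_exp (D : R * R -> Prop) h : open D -> smooth2 D h -> smooth2 D (fun x y => exp (h x y)).
Proof.
  intros HD Hh. apply smooth2_Ck; auto. intros n. apply Ck_exp; auto.
  apply smooth2_Ck; auto.
Qed.

Lemma smooth2_comp (V U : R * R -> Prop) h a b :
  open V -> open U -> (forall u v : R, V (u, v) -> U (a u v, b u v)) ->
  smooth2 U h -> smooth2 V a -> smooth2 V b ->
  smooth2 V (fun u v => h (a u v) (b u v)).
Proof.
  intros HV HU HVU Hh Ha Hb. apply smooth2_Ck; auto. intros n.
  apply Ck_comp with U; auto; apply smooth2_Ck; auto.
Qed.

(** The chain rule in terms of [du] and [dv]. *)
Lemma smooth2_comp_partials (V U : R * R -> Prop) h a au av b bu bv :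
  open U -> smooth2 U h ->
  partials V a au av -> partials V b bu bv ->
  (forall u v : R, V (u, v) -> U (a u v, b u v)) ->
  partials V (fun u v => h (a u v) (b u v))
    (fun u v => du h (a u v) (b u v) * au u v + dv h (a u v) (b u v) * bu u v)
    (fun u v => du h (a u v) (b u v) * av u v + dv h (a u v) (b u v) * bv u v).
Proof.
  intros HU Hh Ha Hb HVU. apply partials_comp with U; auto using smooth2_partials.
  apply smooth2_Ck; auto using smooth2_du.
Qed.

(** Mixed second partial derivatives agree. *)
Lemma smooth2_Schwarz (D : R * R -> Prop) h x y :
  open D -> smooth2 D h -> D (x, y) -> du (dv h) x y = dv (du h) x y.
Proof.
  intros HD Hh Hxy. unfold du, dv. apply Schwarz.
  - destruct (open_locally_2d D x y HD Hxy) as [d Hd]. exists d.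
    intros u v Hu Hv. specialize (Hd u v Hu Hv).
    destruct (Hh u v Hd 2%nat) as (_ & H1 & H2 & (_ & _ & H3 & _) & (_ & H4 & _ & _)).
    auto.
  - apply (smooth2_cont D (du (dv h))); auto using smooth2_du, smooth2_dv.
  - apply (smooth2_cont D (dv (du h))); auto using smooth2_du, smooth2_dv.
Qed.

(** Composition with a function of one variable that is smooth on an interval;
    its derivatives are composed at the same time. *)
Lemma smooth2_comp1_n (D : R * R -> Prop) K F nu j :
  open D -> smooth1 K F -> (forall x y : R, D (x, y) -> K (nu x y)) -> smooth2 D nu ->
  smooth2 D (fun x y => Derive_n F j (nu x y)).
Proof.
  intros HD HF HK Hnu. apply smooth2_Ck; auto. intros n.
  apply (Ck_comp1 n D K (Derive_n F)); auto.
  - intros i t Ht. apply Derive_correct.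
    apply (locally_singleton _ _ (HF t Ht) (S i)).
  - apply smooth2_Ck; auto.
Qed.

(** * Squares, the Poincare lemma and connectedness *)

(** The open square with centre [(x0, y0)] and side [2 r]: a ball for the
    maximum norm. *)
Definition square (x0 y0 r : R) : R * R -> Prop :=
  fun q => Rabs (fst q - x0) < r /\ Rabs (snd q - y0) < r.

Lemma square_open x0 y0 r : open (square x0 y0 r).
Proof.
  intros [x y] [Hx Hy]; simpl in Hx, Hy.
  assert (Hm : 0 < Rmin (r - Rabs (x - x0)) (r - Rabs (y - y0)))
    by (apply Rmin_case; lra).
  exists (mkposreal _ Hm). intros [u v] [Hu Hv].
  change (Rabs (u - x) < Rmin (r - Rabs (x - x0)) (r - Rabs (y - y0))) in Hu.
  change (Rabs (v - y) < Rmin (r - Rabs (x - x0)) (r - Rabs (y - y0))) in Hv.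
  pose proof (Rmin_l (r - Rabs (x - x0)) (r - Rabs (y - y0))).
  pose proof (Rmin_r (r - Rabs (x - x0)) (r - Rabs (y - y0))).
  split; simpl.
  - replace (u - x0) with ((u - x) + (x - x0)) by ring.
    pose proof (Rabs_triang (u - x) (x - x0)). lra.
  - replace (v - y0) with ((v - y) + (y - y0)) by ring.
    pose proof (Rabs_triang (v - y) (y - y0)). lra.
Qed.

Lemma square_center x0 y0 r : 0 < r -> square x0 y0 r (x0, y0).
Proof. intros Hr. split; simpl; rewrite Rminus_diag, Rabs_R0; exact Hr. Qed.

Lemma open_square (D : R * R -> Prop) x0 y0 :
  open D -> D (x0, y0) -> exists r, 0 < r /\ forall q, square x0 y0 r q -> D q.
Proof.
  intros HD H0. destruct (HD _ H0) as [d Hd]. exists d. split; [apply cond_pos|].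
  intros [x y] [Hx Hy]. apply Hd. split; [exact Hx | exact Hy].
Qed.

Lemma Rabs_segment x0 x t r :
  Rabs (x - x0) < r -> Rmin x0 x <= t <= Rmax x0 x -> Rabs (t - x0) < r.
Proof.
  intros Hx [H1 H2]. apply Rabs_def2 in Hx. apply Rabs_def1.
  - revert H2. apply Rmax_case; lra.
  - revert H1. apply Rmin_case; lra.
Qed.

Lemma Rabs_convex x0 a b t r :
  Rabs (a - x0) < r -> Rabs (b - x0) < r -> 0 <= t <= 1 ->
  Rabs (a + t * (b - a) - x0) < r.
Proof.
  intros Ha Hb Ht. apply Rabs_def2 in Ha, Hb.
  destruct (Req_dec t 0) as [->|H0]; [apply Rabs_def1; lra|].
  assert (0 < t * (r - (b - x0))) by (apply Rmult_lt_0_compat; lra).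
  assert (0 < t * (r + (b - x0))) by (apply Rmult_lt_0_compat; lra).
  assert (0 <= (1 - t) * (r - (a - x0))) by (apply Rmult_le_pos; lra).
  assert (0 <= (1 - t) * (r + (a - x0))) by (apply Rmult_le_pos; lra).
  apply Rabs_def1; nra.
Qed.

Lemma continuity_2d_slice1 h x y :
  continuity_2d_pt h x y -> continuous (fun t => h t y) x.
Proof.
  intros H. apply continuity_pt_filterlim. apply continuity_pt_locally.
  intros eps. destruct (H eps) as [d Hd]. exists d. intros t Ht.
  apply Hd; [exact Ht | rewrite Rminus_diag, Rabs_R0; apply cond_pos].
Qed.

Lemma continuity_2d_slice2 h x y :
  continuity_2d_pt h x y -> continuous (fun t => h x t) y.
Proof.
  intros H. apply continuity_pt_filterlim. apply continuity_pt_locally.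
  intros eps. destruct (H eps) as [d Hd]. exists d. intros t Ht.
  apply Hd; [rewrite Rminus_diag, Rabs_R0; apply cond_pos | exact Ht].
Qed.

(** A primitive of a function that is continuous on an interval around the
    base point. *)
Lemma is_derive_primitive (h : R -> R) x0 r x :
  (forall t, Rabs (t - x0) < r -> continuous h t) -> Rabs (x - x0) < r ->
  is_derive (fun t => RInt h x0 t) x (h x).
Proof.
  intros Hc Hx. apply (is_derive_RInt h (fun t => RInt h x0 t) x0 x); auto.
  assert (Hm : 0 < r - Rabs (x - x0)) by lra.
  exists (mkposreal _ Hm). intros t Ht.
  change (Rabs (t - x) < r - Rabs (x - x0)) in Ht.
  apply (RInt_correct h x0 t), ex_RInt_continuous.
  intros z Hz. apply Hc. apply Rabs_segment with t; auto.
  replace (t - x0) with ((t - x) + (x - x0)) by ring.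
  pose proof (Rabs_triang (t - x) (x - x0)). lra.
Qed.

(** The Poincare lemma for closed one-forms [P dx + Q dy] on a square. *)
Lemma Poincare_square x0 y0 r P Q :
  smooth2 (square x0 y0 r) P -> smooth2 (square x0 y0 r) Q ->
  (forall x y, square x0 y0 r (x, y) -> dv P x y = du Q x y) ->
  exists s, partials (square x0 y0 r) s P Q.
Proof.
  intros HP HQ Hcl.
  exists (fun x y => RInt (fun t => P t y0) x0 x + RInt (fun t => Q x t) y0 y).
  intros x y [Hx Hy]; simpl in Hx, Hy.
  assert (Hr : 0 < r) by (pose proof (Rabs_pos (x - x0)); lra).
  assert (Hy0 : Rabs (y0 - y0) < r) by (rewrite Rminus_diag, Rabs_R0; exact Hr).
  assert (HQc : forall u t, Rabs (u - x0) < r -> Rabs (t - y0) < r ->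
     continuous (fun t => Q u t) t).
  { intros u t Hu Ht. apply continuity_2d_slice2, (smooth2_cont (square x0 y0 r) Q); auto.
    split; assumption. }
  assert (Hm : 0 < r - Rabs (x - x0)) by lra.
  assert (Hloc : forall u, Rabs (u - x) < r - Rabs (x - x0) -> Rabs (u - x0) < r).
  { intros u Hu. replace (u - x0) with ((u - x) + (x - x0)) by ring.
    pose proof (Rabs_triang (u - x) (x - x0)). lra. }
  split.
  - (* differentiate under the integral sign and use [Q_x = P_y] *)
    replace (P x y) with (P x y0 + RInt (fun t => Derive (fun u => Q u t) x) y0 y).
    + apply @is_derive_plus.
      * apply (is_derive_primitive (fun t => P t y0) x0 r); auto.
        intros t Ht. apply continuity_2d_slice1, (smooth2_cont _ P _ _ HP).
        split; assumption.
      * apply (is_derive_RInt_param (fun u t => Q u t) y0 y x).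
        -- exists (mkposreal _ Hm). intros u Hu t Ht.
           eexists. apply (smooth2_partials _ _ HQ).
           split; simpl; [apply Hloc; exact Hu | apply Rabs_segment with y; auto].
        -- intros t Ht. apply (smooth2_cont _ (du Q) x t (smooth2_du _ _ HQ)).
           split; simpl; [assumption | apply Rabs_segment with y; auto].
        -- exists (mkposreal _ Hm). intros u Hu. apply @ex_RInt_continuous.
           intros t Ht. apply HQc; [apply Hloc; exact Hu | apply Rabs_segment with y; auto].
    + rewrite (RInt_ext _ (Derive (fun t => P x t))).
      * rewrite RInt_Derive; [ring | |].
        -- intros t Ht. eexists. apply (smooth2_partials _ _ HP).
           split; simpl; [assumption | apply Rabs_segment with y; auto].
        -- intros t Ht.
           apply (continuity_2d_slice2 (dv P) x t),
             (smooth2_cont _ _ _ _ (smooth2_dv _ _ HP)).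
           split; simpl; [assumption | apply Rabs_segment with y; auto].
      * intros t Ht. symmetry. apply Hcl.
        split; simpl; [assumption | apply Rabs_segment with y; auto; lra].
  - apply is_derive_ext with (fun t => RInt (fun t => Q x t) y0 t + RInt (fun t => P t y0) x0 x).
    { intros; apply Rplus_comm. }
    replace (Q x y) with (Q x y + 0) by ring.
    apply @is_derive_plus; [|apply @is_derive_const].
    apply (is_derive_primitive (fun t => Q x t) y0 r); auto.
Qed.

(** Squares are connected: on the segment from a point of [A] to a point
    of [B], the supremum of the initial pieces inside [A] is a point of neither
    set unless they meet. *)
Lemma square_domain x0 y0 r : 0 < r -> is_domain (square x0 y0 r).
Proof.
  intros Hr. split; [apply square_open|]. split; [exists (x0, y0); apply square_center, Hr|].
  intros A B HA HB Hcov [[a1 a2] [Ha HAa]] [[b1 b2] [Hb HBb]].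
  apply NNPP. intros Hno.
  set (gam := fun t => (a1 + t * (b1 - a1), a2 + t * (b2 - a2))).
  assert (Hg : forall t, 0 <= t <= 1 -> square x0 y0 r (gam t)).
  { intros t Ht. destruct Ha as [Ha1 Ha2], Hb as [Hb1 Hb2]; simpl in *.
    split; simpl; apply Rabs_convex; assumption. }
  assert (Hgc : forall O t, open O -> O (gam t) -> locally t (fun s => O (gam s))).
  { intros O t HO Ht. assert (Hc : continuous gam t).
    { assert (Hlin : forall a b, continuous (fun t => a + t * b) t).
      { intros a b. apply (ex_derive_continuous (fun t => a + t * b)). auto_derive; auto. }
      apply (continuous_comp_2 (fun t => a1 + t * (b1 - a1)) (fun t => a2 + t * (b2 - a2))
        (fun a b => (a, b))); auto.
      apply continuous_ext with (fun q => q); [intros []; reflexivity|].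
      apply continuous_id. }
    apply Hc. apply HO, Ht. }
  (* the last parameter up to which the segment stays in [A] *)
  set (E := fun t => 0 <= t <= 1 /\ forall s, 0 <= s <= t -> A (gam s)).
  destruct (completeness E) as [m [Hub Hlub]].
  { exists 1. intros t [Ht _]. lra. }
  { exists 0. split; [lra|]. intros s Hs. replace s with 0 by lra.
    unfold gam. rewrite !Rmult_0_l, !Rplus_0_r. exact HAa. }
  assert (Hm0 : 0 <= m).
  { apply Hub. split; [lra|]. intros s Hs. replace s with 0 by lra.
    unfold gam. rewrite !Rmult_0_l, !Rplus_0_r. exact HAa. }
  assert (Hm1 : m <= 1) by (apply Hlub; intros t [Ht _]; lra).
  assert (Hbelow : forall s, 0 <= s < m -> A (gam s)).
  { intros s Hs. apply NNPP. intros HnA. apply (Rlt_not_le m s); [lra|].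
    apply Hlub. intros t [Ht HtA]. apply Rnot_lt_le. intros Hst.
    apply HnA, HtA. lra. }
  destruct (Hcov _ (Hg m (conj Hm0 Hm1))) as [HAm | HBm].
  - destruct (Hgc A m HA HAm) as [d Hd]. pose proof (cond_pos d) as Hdpos.
    destruct (Req_dec m 1) as [->|Hne].
    + apply Hno. exists (b1, b2). split; [exact Hb|]. split; [|exact HBb].
      replace (b1, b2) with (gam 1) by (unfold gam; f_equal; ring). exact HAm.
    + assert (Hin : E (Rmin 1 (m + d / 2))).
      { split; [split; [apply Rmin_case; lra | apply Rmin_l]|].
        intros s Hs. pose proof (Rmin_r 1 (m + d / 2)).
        destruct (Rlt_le_dec s m) as [Hl|Hl]; [apply Hbelow; lra|].
        apply Hd. apply Rabs_def1; simpl; unfold minus, plus, opp; simpl; lra. }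
      apply Hub in Hin. revert Hin. apply Rmin_case; lra.
  - destruct (Hgc B m HB HBm) as [d Hd]. pose proof (cond_pos d) as Hdpos.
    destruct (Req_dec m 0) as [->|Hne].
    + apply Hno. exists (a1, a2). split; [exact Ha|]. split; [exact HAa|].
      replace (a1, a2) with (gam 0) by (unfold gam; f_equal; ring). exact HBm.
    + assert (Hs : 0 <= Rmax 0 (m - d / 2) < m) by (split; [apply Rmax_l | apply Rmax_case; lra]).
      apply Hno. exists (gam (Rmax 0 (m - d / 2))).
      split; [apply Hg; lra|]. split; [apply Hbelow, Hs|].
      apply Hd. pose proof (Rmax_r 0 (m - d / 2)).
      apply Rabs_def1; simpl; unfold minus, plus, opp; simpl; lra.
Qed.

(** * The inverse function theorem *)

(** A sequence whose steps are dominated by a geometric sequence of ratio [1/2]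
    converges. *)
Lemma geometric_steps_lim (u : nat -> R) c :
  (forall n, Rabs (u (S n) - u n) <= c * (/ 2) ^ n) -> ex_finite_lim_seq u.
Proof.
  intros Hu.
  assert (Hs : ex_series (fun n => u (S n) - u n)).
  { apply @ex_series_le with (b := fun n => c * (/ 2) ^ n); [exact Hu|].
    apply (ex_series_scal c (fun n => (/ 2) ^ n)), ex_series_geom.
    rewrite Rabs_right; lra. }
  destruct Hs as [l Hl]. exists (u O + l).
  apply is_lim_seq_incr_1.
  apply is_lim_seq_ext with (fun n => u O + sum_n (fun k => u (S k) - u k) n).
  { induction n as [|n IH].
    - rewrite sum_O. ring.
    - rewrite sum_Sn. unfold plus; simpl. rewrite <- Rplus_assoc, IH. ring. }
  apply is_lim_seq_plus'; [apply is_lim_seq_const | exact Hl].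
Qed.

(** Banach's fixed point theorem on a closed square, for the maximum norm. *)
Lemma fixed_point_square (T1 T2 : R -> R -> R) x0 y0 r :
  0 < r ->
  (forall x y, Rabs (x - x0) <= r -> Rabs (y - y0) <= r ->
     Rabs (T1 x y - x0) <= r /\ Rabs (T2 x y - y0) <= r) ->
  (forall x y x' y', Rabs (x - x0) <= r -> Rabs (y - y0) <= r ->
     Rabs (x' - x0) <= r -> Rabs (y' - y0) <= r ->
     forall m, Rabs (x - x') <= m -> Rabs (y - y') <= m ->
     Rabs (T1 x y - T1 x' y') <= m / 2 /\ Rabs (T2 x y - T2 x' y') <= m / 2) ->
  exists x y, Rabs (x - x0) <= r /\ Rabs (y - y0) <= r /\ T1 x y = x /\ T2 x y = y.
Proof.
  intros Hr Hmap Hlip.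
  set (z := nat_rect (fun _ => (R * R)%type) (x0, y0)
              (fun _ q => (T1 (fst q) (snd q), T2 (fst q) (snd q)))).
  assert (Hin : forall n, Rabs (fst (z n) - x0) <= r /\ Rabs (snd (z n) - y0) <= r).
  { induction n as [|n IH]; simpl.
    - rewrite !Rminus_diag, Rabs_R0. lra.
    - apply Hmap; apply IH. }
  assert (Hstep : forall n, Rabs (fst (z (S n)) - fst (z n)) <= r * (/ 2) ^ n /\
                            Rabs (snd (z (S n)) - snd (z n)) <= r * (/ 2) ^ n).
  { induction n as [|n IH].
    - rewrite pow_O, Rmult_1_r. apply (Hin 1%nat).
    - change (fst (z (S (S n)))) with (T1 (fst (z (S n))) (snd (z (S n)))).
      change (snd (z (S (S n)))) with (T2 (fst (z (S n))) (snd (z (S n)))).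
      change (fst (z (S n))) with (T1 (fst (z n)) (snd (z n))) at 2.
      change (snd (z (S n))) with (T2 (fst (z n)) (snd (z n))) at 3.
      replace (r * (/ 2) ^ S n) with (r * (/ 2) ^ n / 2) by (simpl; field).
      apply Hlip; try apply Hin; apply IH. }
  destruct (geometric_steps_lim (fun n => fst (z n)) r) as [x Hx];
    [intros n; apply Hstep|].
  destruct (geometric_steps_lim (fun n => snd (z n)) r) as [y Hy];
    [intros n; apply Hstep|].
  assert (Hcl : forall (w : nat -> R) (l c : R), is_lim_seq w l ->
     (forall n, Rabs (w n - c) <= r) -> Rabs (l - c) <= r).
  { intros w l c Hw Hb.
    apply (is_lim_seq_le (fun n => Rabs (w n - c)) (fun _ => r) (Rabs (l - c)) r);
      [exact Hb | | apply is_lim_seq_const].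
    apply (is_lim_seq_abs (fun n => w n - c) (l - c)).
    apply is_lim_seq_minus'; [exact Hw | apply is_lim_seq_const]. }
  pose proof (Hcl _ _ _ Hx (fun n => proj1 (Hin n))) as Hxr.
  pose proof (Hcl _ _ _ Hy (fun n => proj2 (Hin n))) as Hyr.
  exists x, y. split; [exact Hxr|]. split; [exact Hyr|].
  assert (Happ : forall eps : posreal, exists n, Rabs (fst (z n) - x) < eps /\
     Rabs (snd (z n) - y) < eps /\ Rabs (fst (z (S n)) - x) < eps /\
     Rabs (snd (z (S n)) - y) < eps).
  { intros eps. apply is_lim_seq_spec in Hx, Hy.
    destruct (Hx eps) as [n1 H1], (Hy eps) as [n2 H2].
    exists (n1 + n2)%nat. repeat split; [apply H1|apply H2|apply H1|apply H2]; lia. }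
  assert (Hz : forall w, (forall eps : posreal, Rabs w <= 2 * eps) -> w = 0).
  { intros w Hw. destruct (Req_dec w 0) as [|Hne]; auto.
    assert (Hp : 0 < Rabs w / 3) by (pose proof (Rabs_pos_lt w Hne); lra).
    specialize (Hw (mkposreal _ Hp)). simpl in Hw. lra. }
  split; apply Rminus_diag_uniq, Hz; intros eps;
    destruct (Happ eps) as [n (H1 & H2 & H3 & H4)];
    destruct (Hlip x y (fst (z n)) (snd (z n)) Hxr Hyr (proj1 (Hin n)) (proj2 (Hin n)) eps)
      as [L1 L2]; try (rewrite Rabs_minus_sym; lra).
  - replace (T1 x y - x) with ((T1 x y - T1 (fst (z n)) (snd (z n))) + (fst (z (S n)) - x))
      by (simpl; ring).
    pose proof (Rabs_triang (T1 x y - T1 (fst (z n)) (snd (z n))) (fst (z (S n)) - x)).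
    pose proof (cond_pos eps). lra.
  - replace (T2 x y - y) with ((T2 x y - T2 (fst (z n)) (snd (z n))) + (snd (z (S n)) - y))
      by (simpl; ring).
    pose proof (Rabs_triang (T2 x y - T2 (fst (z n)) (snd (z n))) (snd (z (S n)) - y)).
    pose proof (cond_pos eps). lra.
Qed.

(** A function whose partial derivatives are bounded by [1/4] on a square
    contracts the maximum norm by the factor [1/2]. *)
Lemma partials_lipschitz x0 y0 r h hx hy :
  partials (square x0 y0 r) h hx hy ->
  (forall x y, square x0 y0 r (x, y) -> Rabs (hx x y) <= / 4 /\ Rabs (hy x y) <= / 4) ->
  forall x y x' y' m, square x0 y0 r (x, y) -> square x0 y0 r (x', y') ->
  Rabs (x - x') <= m -> Rabs (y - y') <= m -> Rabs (h x y - h x' y') <= m / 2.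
Proof.
  intros Hp Hb x y x' y' m [Hx Hy] [Hx' Hy'] Hm1 Hm2; simpl in *.
  assert (Hseg : forall c a b t, Rabs (a - c) < r -> Rabs (b - c) < r ->
     Rmin a b <= t <= Rmax a b -> Rabs (t - c) < r).
  { intros c a b t Ha Hbb [H1 H2]. apply Rabs_def2 in Ha, Hbb. apply Rabs_def1.
    - revert H2. apply Rmax_case; lra.
    - revert H1. apply Rmin_case; lra. }
  assert (Hd1 : forall t, Rmin x' x <= t <= Rmax x' x ->
     is_derive (fun t => h t y) t (hx t y) /\ Rabs (hx t y) <= / 4).
  { intros t Ht. assert (Hsq : square x0 y0 r (t, y)).
    { split; simpl; [apply (Hseg _ x' x) | ]; auto. }
    split; [apply Hp | apply Hb]; auto. }
  assert (Hd2 : forall t, Rmin y' y <= t <= Rmax y' y ->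
     is_derive (fun t => h x' t) t (hy x' t) /\ Rabs (hy x' t) <= / 4).
  { intros t Ht. assert (Hsq : square x0 y0 r (x', t)).
    { split; simpl; [| apply (Hseg _ y' y)]; auto. }
    split; [apply Hp | apply Hb]; auto. }
  assert (Hcp : forall (k : R -> R) (dk : R) t, is_derive k t dk -> continuity_pt k t).
  { intros k dk t Hk. apply derivable_continuous_pt. exists dk. apply is_derive_Reals, Hk. }
  destruct (MVT_gen (fun t => h t y) x' x (fun t => hx t y)) as [c [Hc E1]].
  { intros t Ht. apply Hd1. lra. }
  { intros t Ht. eapply Hcp. apply Hd1. lra. }
  destruct (MVT_gen (fun t => h x' t) y' y (fun t => hy x' t)) as [d [Hd E2]].
  { intros t Ht. apply Hd2. lra. }
  { intros t Ht. eapply Hcp. apply Hd2. lra. }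
  replace (h x y - h x' y') with (hx c y * (x - x') + hy x' d * (y - y')) by lra.
  eapply Rle_trans; [apply Rabs_triang|]. rewrite !Rabs_mult.
  assert (Rabs (hx c y) * Rabs (x - x') <= / 4 * m).
  { apply Rmult_le_compat; auto using Rabs_pos. apply Hd1, Hc. }
  assert (Rabs (hy x' d) * Rabs (y - y') <= / 4 * m).
  { apply Rmult_le_compat; auto using Rabs_pos. apply Hd2, Hd. }
  lra.
Qed.

(** Derivative of a curve [(a, b)] that is known only to be Lipschitz at [tau]
    and whose image under [(s, t)] is a straight line. *)
Lemma inverse_is_derive s t (a b : R -> R) tau p1 q1 p2 q2 al be C :
  differentiable_pt_lim s (a tau) (b tau) p1 q1 ->
  differentiable_pt_lim t (a tau) (b tau) p2 q2 ->
  p1 * q2 - q1 * p2 <> 0 -> 0 < C ->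
  locally tau (fun z => Rabs (a z - a tau) <= C * Rabs (z - tau) /\
    Rabs (b z - b tau) <= C * Rabs (z - tau) /\
    s (a z) (b z) - s (a tau) (b tau) = al * (z - tau) /\
    t (a z) (b z) - t (a tau) (b tau) = be * (z - tau)) ->
  is_derive a tau ((q2 * al - q1 * be) / (p1 * q2 - q1 * p2)) /\
  is_derive b tau ((p1 * be - p2 * al) / (p1 * q2 - q1 * p2)).
Proof.
  intros Hs Ht Hdet HC [d Hloc].
  set (det := p1 * q2 - q1 * p2) in *.
  set (m := Rabs p1 + Rabs q1 + Rabs p2 + Rabs q2 + 1).
  assert (Hm : 0 < m).
  { unfold m. pose proof (Rabs_pos p1); pose proof (Rabs_pos q1);
    pose proof (Rabs_pos p2); pose proof (Rabs_pos q2); lra. }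
  assert (Hdp : 0 < Rabs det) by (apply Rabs_pos_lt; auto).
  (* the increments of [(a, b)] solve the linearized equations up to small errors *)
  assert (Hmain : forall eps, 0 < eps -> exists delta : posreal, forall h, h <> 0 ->
    Rabs h < delta ->
    exists e1 e2, Rabs e1 <= eps * Rabs det / (2 * m) * Rabs h /\
      Rabs e2 <= eps * Rabs det / (2 * m) * Rabs h /\
      p1 * (a (tau + h) - a tau) + q1 * (b (tau + h) - b tau) = al * h + e1 /\
      p2 * (a (tau + h) - a tau) + q2 * (b (tau + h) - b tau) = be * h + e2).
  { intros eps Heps.
    assert (He : 0 < eps * Rabs det / (2 * m) / C).
    { repeat apply Rdiv_lt_0_compat; try lra. apply Rmult_lt_0_compat; lra. }
    destruct (Hs (mkposreal _ He)) as [d1 H1], (Ht (mkposreal _ He)) as [d2 H2].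
    simpl in H1, H2.
    assert (Hdl : 0 < Rmin d (Rmin d1 d2 / C)).
    { apply Rmin_case; [apply cond_pos|]. apply Rdiv_lt_0_compat; auto.
      apply Rmin_case; apply cond_pos. }
    exists (mkposreal _ Hdl). simpl. intros h Hh0 Hh.
    pose proof (Rmin_l d (Rmin d1 d2 / C)). pose proof (Rmin_r d (Rmin d1 d2 / C)).
    assert (HCh : C * Rabs h < Rmin d1 d2).
    { apply Rlt_le_trans with (C * (Rmin d1 d2 / C)); [|right; field; lra].
      apply Rmult_lt_compat_l; lra. }
    pose proof (Rmin_l d1 d2). pose proof (Rmin_r d1 d2).
    destruct (Hloc (tau + h)) as (La & Lb & Es & Et).
    { change (Rabs (tau + h - tau) < d). replace (tau + h - tau) with h by ring. lra. }
    replace (tau + h - tau) with h in La, Lb, Es, Et by ring.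
    specialize (H1 (a (tau + h)) (b (tau + h)) ltac:(lra) ltac:(lra)).
    specialize (H2 (a (tau + h)) (b (tau + h)) ltac:(lra) ltac:(lra)).
    rewrite Es in H1. rewrite Et in H2.
    assert (Hmax : eps * Rabs det / (2 * m) / C *
       Rmax (Rabs (a (tau + h) - a tau)) (Rabs (b (tau + h) - b tau)) <=
       eps * Rabs det / (2 * m) * Rabs h).
    { apply Rle_trans with (eps * Rabs det / (2 * m) / C * (C * Rabs h)).
      - apply Rmult_le_compat_l; [lra|]. apply Rmax_case; assumption.
      - right. field. split; lra. }
    exists (p1 * (a (tau + h) - a tau) + q1 * (b (tau + h) - b tau) - al * h),
           (p2 * (a (tau + h) - a tau) + q2 * (b (tau + h) - b tau) - be * h).
    rewrite Rabs_minus_sym in H1, H2.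
    repeat split; try lra. }
  (* error estimate for one component obtained by Cramer's rule *)
  assert (Hfin : forall eps h x k c1 c2 e1 e2, 0 < eps -> h <> 0 ->
     Rabs c1 + Rabs c2 <= m ->
     Rabs e1 <= eps * Rabs det / (2 * m) * Rabs h ->
     Rabs e2 <= eps * Rabs det / (2 * m) * Rabs h ->
     x * det = k * h + (c1 * e1 + c2 * e2) -> Rabs (x / h - k / det) < eps).
  { intros eps h x k c1 c2 e1 e2 Heps Hh Hc He1 He2 E.
    replace (x / h - k / det) with ((c1 * e1 + c2 * e2) / (h * det)).
    2:{ replace (c1 * e1 + c2 * e2) with (x * det - k * h) by lra. field. auto. }
    pose proof (Rabs_pos_lt h Hh) as Hhp.
    unfold Rdiv. rewrite Rabs_mult, Rabs_inv, Rabs_mult.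
    assert (0 < Rabs h * Rabs det) by (apply Rmult_lt_0_compat; auto).
    apply Rmult_lt_reg_r with (Rabs h * Rabs det); auto.
    rewrite Rmult_assoc, Rinv_l, Rmult_1_r by lra.
    eapply Rle_lt_trans; [apply Rabs_triang|]. rewrite !Rabs_mult.
    set (w := eps * Rabs det / (2 * m) * Rabs h) in *.
    assert (Hw : w * m = eps * (Rabs h * Rabs det) / 2) by (unfold w; field; lra).
    assert (0 < eps * (Rabs h * Rabs det)) by (apply Rmult_lt_0_compat; auto).
    assert (Rabs c1 * Rabs e1 <= Rabs c1 * w) by (apply Rmult_le_compat_l; auto using Rabs_pos).
    assert (Rabs c2 * Rabs e2 <= Rabs c2 * w) by (apply Rmult_le_compat_l; auto using Rabs_pos).
    assert (0 <= w) by (apply Rle_trans with (2 := He1), Rabs_pos).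
    assert ((Rabs c1 + Rabs c2) * w <= m * w) by (apply Rmult_le_compat_r; auto).
    lra. }
  split; apply is_derive_Reals; intros eps Heps; destruct (Hmain eps Heps) as [delta Hde];
    exists delta; intros h Hh0 Hh; destruct (Hde h Hh0 Hh) as (e1 & e2 & B1 & B2 & E1 & E2).
  - apply (Hfin eps h _ _ q2 (- q1) e1 e2); auto.
    + rewrite Rabs_Ropp. unfold m. pose proof (Rabs_pos p1); pose proof (Rabs_pos p2). lra.
    + unfold det.
      transitivity (q2 * (al * h + e1) - q1 * (be * h + e2)); [rewrite <- E1, <- E2|]; ring.
  - apply (Hfin eps h _ _ (- p2) p1 e1 e2); auto.
    + rewrite Rabs_Ropp. unfold m. pose proof (Rabs_pos q1); pose proof (Rabs_pos q2). lra.
    + unfold det.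
      transitivity (p1 * (be * h + e2) - p2 * (al * h + e1)); [rewrite <- E1, <- E2|]; ring.
Qed.

Lemma continuity_2d_small h x0 y0 eps :
  0 < eps -> continuity_2d_pt h x0 y0 -> h x0 y0 = 0 ->
  exists r, 0 < r /\ forall x y, square x0 y0 r (x, y) -> Rabs (h x y) < eps.
Proof.
  intros He Hc H0. destruct (Hc (mkposreal _ He)) as [d Hd].
  exists d. split; [apply cond_pos|]. intros x y [Hx Hy].
  specialize (Hd x y Hx Hy). rewrite H0, Rminus_0_r in Hd. exact Hd.
Qed.

Lemma square_le x0 y0 r r' q : r <= r' -> square x0 y0 r q -> square x0 y0 r' q.
Proof. intros Hr [H1 H2]. split; lra. Qed.

(** The inverse function theorem, with the derivative of the local inverse. *)
Lemma inverse_function (D : R * R -> Prop) s t P1 Q1 P2 Q2 x0 y0 :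
  open D -> D (x0, y0) ->
  partials D s P1 Q1 -> partials D t P2 Q2 ->
  smooth2 D P1 -> smooth2 D Q1 -> smooth2 D P2 -> smooth2 D Q2 ->
  (forall x y, D (x, y) -> P1 x y * Q2 x y - Q1 x y * P2 x y <> 0) ->
  exists (V U : R * R -> Prop) (a b : R -> R -> R),
    is_domain V /\ U (x0, y0) /\ (forall q, U q -> D q) /\
    diffeo V U (fun u v => (a u v, b u v)) /\
    let det x y := P1 x y * Q2 x y - Q1 x y * P2 x y in
    partials V a (fun u v => Q2 (a u v) (b u v) / det (a u v) (b u v))
                 (fun u v => - Q1 (a u v) (b u v) / det (a u v) (b u v)) /\
    partials V b (fun u v => - P2 (a u v) (b u v) / det (a u v) (b u v))
                 (fun u v => P1 (a u v) (b u v) / det (a u v) (b u v)).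
Proof.
  intros HD H0 Hs Ht SP1 SQ1 SP2 SQ2 Hdet.
  pose proof (smooth2_intro D s P1 Q1 HD Hs SP1 SQ1) as Ss.
  pose proof (smooth2_intro D t P2 Q2 HD Ht SP2 SQ2) as St.
  pose proof (Hdet x0 y0 H0) as Hdet0.
  set (det := fun x y => P1 x y * Q2 x y - Q1 x y * P2 x y) in *.
  (* [a11 a12; a21 a22] is the inverse of the Jacobian matrix at the centre *)
  set (a11 := Q2 x0 y0 / det x0 y0). set (a12 := - Q1 x0 y0 / det x0 y0).
  set (a21 := - P2 x0 y0 / det x0 y0). set (a22 := P1 x0 y0 / det x0 y0).
  assert (Hinv : forall k l, a11 * k + a12 * l = 0 -> a21 * k + a22 * l = 0 ->
     k = 0 /\ l = 0).
  { intros k l E1 E2. split.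
    - replace k with (P1 x0 y0 * (a11 * k + a12 * l) + Q1 x0 y0 * (a21 * k + a22 * l)).
      + rewrite E1, E2. ring.
      + unfold a11, a12, a21, a22, det in *. field. exact Hdet0.
    - replace l with (P2 x0 y0 * (a11 * k + a12 * l) + Q2 x0 y0 * (a21 * k + a22 * l)).
      + rewrite E1, E2. ring.
      + unfold a11, a12, a21, a22, det in *. field. exact Hdet0. }
  (* [(x, y)] minus the preconditioned map: its derivative vanishes at the centre,
     so it contracts a small square *)
  set (N1 := fun x y => x - (a11 * s x y + a12 * t x y)).
  set (N2 := fun x y => y - (a21 * s x y + a22 * t x y)).
  set (N1x := fun x y => 1 - (a11 * P1 x y + a12 * P2 x y)).
  set (N1y := fun x y => 0 - (a11 * Q1 x y + a12 * Q2 x y)).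
  set (N2x := fun x y => 0 - (a21 * P1 x y + a22 * P2 x y)).
  set (N2y := fun x y => 1 - (a21 * Q1 x y + a22 * Q2 x y)).
  assert (HN1 : partials D N1 N1x N1y).
  { intros x y Hxy. destruct (Hs x y Hxy), (Ht x y Hxy). unfold N1, N1x, N1y. split.
    - apply @is_derive_minus; [apply @is_derive_id|].
      apply @is_derive_plus; apply is_derive_scal; assumption.
    - apply @is_derive_minus; [apply @is_derive_const|].
      apply @is_derive_plus; apply is_derive_scal; assumption. }
  assert (HN2 : partials D N2 N2x N2y).
  { intros x y Hxy. destruct (Hs x y Hxy), (Ht x y Hxy). unfold N2, N2x, N2y. split.
    - apply @is_derive_minus; [apply @is_derive_const|].
      apply @is_derive_plus; apply is_derive_scal; assumption.
    - apply @is_derive_minus; [apply @is_derive_id|].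
      apply @is_derive_plus; apply is_derive_scal; assumption. }
  assert (Hlc : forall k l h1 h2, smooth2 D h1 -> smooth2 D h2 -> forall c,
     c - (k * h1 x0 y0 + l * h2 x0 y0) = 0 ->
     exists r, 0 < r /\ forall x y, square x0 y0 r (x, y) ->
       Rabs (c - (k * h1 x y + l * h2 x y)) < / 4).
  { intros k l h1 h2 S1 S2 c Hc.
    apply (continuity_2d_small (fun x y => c - (k * h1 x y + l * h2 x y))); auto; [lra|].
    apply smooth2_cont with D; auto.
    auto using smooth2_minus, smooth2_plus, smooth2_mult, smooth2_const. }
  destruct (Hlc a11 a12 P1 P2 SP1 SP2 1) as [r1 [Hr1 B1]].
  { unfold a11, a12, det in *. field. exact Hdet0. }
  destruct (Hlc a11 a12 Q1 Q2 SQ1 SQ2 0) as [r2 [Hr2 B2]].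
  { unfold a11, a12, det in *. field. exact Hdet0. }
  destruct (Hlc a21 a22 P1 P2 SP1 SP2 0) as [r3 [Hr3 B3]].
  { unfold a21, a22, det in *. field. exact Hdet0. }
  destruct (Hlc a21 a22 Q1 Q2 SQ1 SQ2 1) as [r4 [Hr4 B4]].
  { unfold a21, a22, det in *. field. exact Hdet0. }
  destruct (open_square D x0 y0 HD H0) as [r5 [Hr5 B5]].
  assert (exists rho, 0 < rho /\ rho <= r1 /\ rho <= r2 /\ rho <= r3 /\ rho <= r4 /\ rho <= r5)
    as (rho & Hrho & Hl1 & Hl2 & Hl3 & Hl4 & Hl5).
  { exists (Rmin r1 (Rmin r2 (Rmin r3 (Rmin r4 r5)))).
    pose proof (Rmin_l r1 (Rmin r2 (Rmin r3 (Rmin r4 r5)))).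
    pose proof (Rmin_r r1 (Rmin r2 (Rmin r3 (Rmin r4 r5)))).
    pose proof (Rmin_l r2 (Rmin r3 (Rmin r4 r5))).
    pose proof (Rmin_r r2 (Rmin r3 (Rmin r4 r5))).
    pose proof (Rmin_l r3 (Rmin r4 r5)). pose proof (Rmin_r r3 (Rmin r4 r5)).
    pose proof (Rmin_l r4 r5). pose proof (Rmin_r r4 r5).
    split; [repeat apply Rmin_case; assumption|]. lra. }
  assert (HsqD : forall q, square x0 y0 rho q -> D q).
  { intros q Hq. apply B5. apply square_le with rho; assumption. }
  assert (L1 : forall x y x' y' m, square x0 y0 rho (x, y) -> square x0 y0 rho (x', y') ->
     Rabs (x - x') <= m -> Rabs (y - y') <= m -> Rabs (N1 x y - N1 x' y') <= m / 2).
  { apply partials_lipschitz with N1x N1y.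
    - intros x y Hxy. apply HN1; auto.
    - intros x y Hxy. split; apply Rlt_le.
      + apply B1, square_le with rho; assumption.
      + apply B2, square_le with rho; assumption. }
  assert (L2 : forall x y x' y' m, square x0 y0 rho (x, y) -> square x0 y0 rho (x', y') ->
     Rabs (x - x') <= m -> Rabs (y - y') <= m -> Rabs (N2 x y - N2 x' y') <= m / 2).
  { apply partials_lipschitz with N2x N2y.
    - intros x y Hxy. apply HN2; auto.
    - intros x y Hxy. split; apply Rlt_le.
      + apply B3, square_le with rho; assumption.
      + apply B4, square_le with rho; assumption. }
  set (r := rho / 2).
  set (A := Rabs a11 + Rabs a12 + Rabs a21 + Rabs a22 + 1).
  assert (HA : 0 < A).
  { unfold A. pose proof (Rabs_pos a11); pose proof (Rabs_pos a12);
    pose proof (Rabs_pos a21); pose proof (Rabs_pos a22); lra. }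
  assert (HAb : forall k l m, Rabs k <= m -> Rabs l <= m ->
     Rabs (a11 * k + a12 * l) <= A * m /\ Rabs (a21 * k + a22 * l) <= A * m).
  { intros k l m Hk Hl. pose proof (Rabs_pos k).
    assert (Hgen : forall c1 c2, Rabs c1 + Rabs c2 <= A -> Rabs (c1 * k + c2 * l) <= A * m).
    { intros c1 c2 Hc. eapply Rle_trans; [apply Rabs_triang|]. rewrite !Rabs_mult.
      assert (Rabs c1 * Rabs k <= Rabs c1 * m) by (apply Rmult_le_compat_l; auto using Rabs_pos).
      assert (Rabs c2 * Rabs l <= Rabs c2 * m) by (apply Rmult_le_compat_l; auto using Rabs_pos).
      assert ((Rabs c1 + Rabs c2) * m <= A * m) by (apply Rmult_le_compat_r; lra). lra. }
    split; apply Hgen; unfold A; pose proof (Rabs_pos a11); pose proof (Rabs_pos a12);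
    pose proof (Rabs_pos a21); pose proof (Rabs_pos a22); lra. }
  (* the inverse is Lipschitz, in particular [(s, t)] is injective *)
  assert (Hlipinv : forall x y x' y' m, square x0 y0 rho (x, y) -> square x0 y0 rho (x', y') ->
     Rabs (s x y - s x' y') <= m -> Rabs (t x y - t x' y') <= m ->
     Rabs (x - x') <= 2 * A * m /\ Rabs (y - y') <= 2 * A * m).
  { intros x y x' y' m Hq Hq' Hsm Htm.
    set (M := Rmax (Rabs (x - x')) (Rabs (y - y'))).
    pose proof (L1 x y x' y' M Hq Hq' (Rmax_l _ _) (Rmax_r _ _)) as E1.
    pose proof (L2 x y x' y' M Hq Hq' (Rmax_l _ _) (Rmax_r _ _)) as E2.
    destruct (HAb _ _ m Hsm Htm) as [F1 F2].
    assert (G1 : Rabs (x - x') <= M / 2 + A * m).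
    { replace (x - x') with ((N1 x y - N1 x' y') +
         (a11 * (s x y - s x' y') + a12 * (t x y - t x' y'))) by (unfold N1; ring).
      eapply Rle_trans; [apply Rabs_triang|]. lra. }
    assert (G2 : Rabs (y - y') <= M / 2 + A * m).
    { replace (y - y') with ((N2 x y - N2 x' y') +
         (a21 * (s x y - s x' y') + a22 * (t x y - t x' y'))) by (unfold N2; ring).
      eapply Rle_trans; [apply Rabs_triang|]. lra. }
    assert (M <= M / 2 + A * m) by (unfold M at 1; apply Rmax_case; assumption).
    lra. }
  set (u0 := s x0 y0). set (v0 := t x0 y0).
  (* a shift of the target by less than [delta] moves the map below by at most
     [r / 4], so that it still maps the closed square into the open one *)
  set (delta := r / (4 * A)).
  assert (Hr : 0 < r) by (unfold r; lra).
  assert (Hdelta : 0 < delta) by (apply Rdiv_lt_0_compat; lra).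
  set (V := square u0 v0 delta).
  assert (Hex : forall u v, V (u, v) ->
     exists q, square x0 y0 r q /\ s (fst q) (snd q) = u /\ t (fst q) (snd q) = v).
  { intros u v [Hu Hv]; simpl in Hu, Hv.
    destruct (HAb (u - u0) (v - v0) delta (Rlt_le _ _ Hu) (Rlt_le _ _ Hv)) as [F1 F2].
    assert (HAd : A * delta = r / 4) by (unfold delta; field; lra).
    assert (Hcl : forall x y, Rabs (x - x0) <= r -> Rabs (y - y0) <= r ->
       square x0 y0 rho (x, y)) by (intros; split; simpl; unfold r in *; lra).
    (* the fixed points of [(T1, T2)] are the solutions of [(s, t) = (u, v)] *)
    set (T1 := fun x y => N1 x y + (a11 * u + a12 * v)).
    set (T2 := fun x y => N2 x y + (a21 * u + a22 * v)).
    assert (Hmap : forall x y, Rabs (x - x0) <= r -> Rabs (y - y0) <= r ->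
      Rabs (T1 x y - x0) < r /\ Rabs (T2 x y - y0) < r).
    { intros x y Hx Hy.
      pose proof (L1 x y x0 y0 r (Hcl x y Hx Hy) (square_center x0 y0 rho Hrho) Hx Hy).
      pose proof (L2 x y x0 y0 r (Hcl x y Hx Hy) (square_center x0 y0 rho Hrho) Hx Hy).
      split.
      - replace (T1 x y - x0) with ((N1 x y - N1 x0 y0) + (a11 * (u - u0) + a12 * (v - v0)))
          by (unfold T1, N1, u0, v0; ring).
        eapply Rle_lt_trans; [apply Rabs_triang|]. lra.
      - replace (T2 x y - y0) with ((N2 x y - N2 x0 y0) + (a21 * (u - u0) + a22 * (v - v0)))
          by (unfold T2, N2, u0, v0; ring).
        eapply Rle_lt_trans; [apply Rabs_triang|]. lra. }
    destruct (fixed_point_square T1 T2 x0 y0 r Hr) as (x & y & Hx & Hy & E1 & E2).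
    - intros x y Hx Hy. destruct (Hmap x y Hx Hy). lra.
    - intros x y x' y' Hx Hy Hx' Hy' m Hm1 Hm2. unfold T1, T2. split.
      + replace (_ - _) with (N1 x y - N1 x' y') by ring. apply L1; auto.
      + replace (_ - _) with (N2 x y - N2 x' y') by ring. apply L2; auto.
    - exists (x, y). simpl. destruct (Hmap x y Hx Hy) as [G1 G2]. rewrite E1 in G1. rewrite E2 in G2.
      split; [split; assumption|].
      destruct (Hinv (s x y - u) (t x y - v)).
      + unfold T1, N1 in E1. lra.
      + unfold T2, N2 in E2. lra.
      + lra. }
  set (phi := fun u v => epsilon (inhabits (0, 0)) (fun q : R * R =>
     square x0 y0 r q /\ s (fst q) (snd q) = u /\ t (fst q) (snd q) = v)).
  assert (Hphi : forall u v, V (u, v) -> square x0 y0 r (phi u v) /\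
     s (fst (phi u v)) (snd (phi u v)) = u /\ t (fst (phi u v)) (snd (phi u v)) = v).
  { intros u v Huv. apply (epsilon_spec (inhabits (0, 0))). apply Hex, Huv. }
  set (a := fun u v => fst (phi u v)). set (b := fun u v => snd (phi u v)).
  assert (Hab : forall u v, V (u, v) -> square x0 y0 r (a u v, b u v) /\
     s (a u v) (b u v) = u /\ t (a u v) (b u v) = v).
  { intros u v Huv. destruct (Hphi u v Huv) as (E & E1 & E2).
    unfold a, b. rewrite <- surjective_pairing. auto. }
  assert (Hr_rho : forall q, square x0 y0 r q -> square x0 y0 rho q).
  { intros q. apply square_le. unfold r. lra. }
  assert (HabD : forall u v, V (u, v) -> D (a u v, b u v)).
  { intros u v Huv. apply HsqD, Hr_rho, Hab, Huv. }
  assert (HVo : open V) by apply square_open.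
  assert (Hlip : forall u v u' v' m, V (u, v) -> V (u', v') ->
     Rabs (u - u') <= m -> Rabs (v - v') <= m ->
     Rabs (a u v - a u' v') <= 2 * A * m /\ Rabs (b u v - b u' v') <= 2 * A * m).
  { intros u v u' v' m HV HV' Hu Hv.
    destruct (Hab u v HV) as (I1 & E1 & E2), (Hab u' v' HV') as (I2 & E3 & E4).
    apply Hlipinv; auto; [rewrite E1, E3 | rewrite E2, E4]; assumption. }
  set (U := fun q : R * R => square x0 y0 r q /\ V (s (fst q) (snd q), t (fst q) (snd q))).
  assert (HUD : forall q, U q -> D q) by (intros q Hq; apply HsqD, Hr_rho, Hq).
  assert (HUo : open U).
  { intros [x y] [Hq HV]; simpl in HV.
    pose proof (square_open x0 y0 r (x, y) Hq) as Lq.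
    assert (Dq : D (x, y)) by (apply HsqD, Hr_rho, Hq).
    pose proof (smooth2_cont D s x y Ss Dq) as Cs. pose proof (smooth2_cont D t x y St Dq) as Ct.
    destruct (HVo _ HV) as [d Hd]. destruct Lq as [d1 H1].
    destruct (Cs d) as [d2 H2], (Ct d) as [d3 H3].
    assert (Hm : 0 < Rmin d1 (Rmin d2 d3)) by (repeat apply Rmin_case; apply cond_pos).
    exists (mkposreal _ Hm). intros [x' y'] [Hx Hy].
    change (Rabs (x' - x) < Rmin d1 (Rmin d2 d3)) in Hx.
    change (Rabs (y' - y) < Rmin d1 (Rmin d2 d3)) in Hy.
    pose proof (Rmin_l d1 (Rmin d2 d3)). pose proof (Rmin_r d1 (Rmin d2 d3)).
    pose proof (Rmin_l d2 d3). pose proof (Rmin_r d2 d3).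
    split.
    - apply H1. split; [change (Rabs (x' - x) < d1) | change (Rabs (y' - y) < d1)]; lra.
    - apply Hd. split; simpl; [apply H2 | apply H3]; lra. }
  assert (Hpart : forall u v, V (u, v) ->
     (is_derive (fun z => a z v) u (Q2 (a u v) (b u v) / det (a u v) (b u v)) /\
      is_derive (fun z => b z v) u (- P2 (a u v) (b u v) / det (a u v) (b u v))) /\
     (is_derive (fun z => a u z) v (- Q1 (a u v) (b u v) / det (a u v) (b u v)) /\
      is_derive (fun z => b u z) v (P1 (a u v) (b u v) / det (a u v) (b u v)))).
  { intros u v Huv. pose proof (HabD u v Huv) as HDuv.
    assert (Ds : differentiable_pt_lim s (a u v) (b u v) (P1 (a u v) (b u v)) (Q1 (a u v) (b u v))).
    { apply partials_differentiable with D; auto. apply smooth2_Ck; auto. }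
    assert (Dt : differentiable_pt_lim t (a u v) (b u v) (P2 (a u v) (b u v)) (Q2 (a u v) (b u v))).
    { apply partials_differentiable with D; auto. apply smooth2_Ck; auto. }
    destruct (Hab u v Huv) as (_ & E1 & E2).
    split.
    - destruct (inverse_is_derive s t (fun z => a z v) (fun z => b z v) u
        _ _ _ _ 1 0 (2 * A) Ds Dt (Hdet _ _ HDuv)) as [G1 G2]; [lra| |].
      + apply filter_imp with (2 := open_slice1 V u v HVo Huv). intros z Hz.
        destruct (Hab z v Hz) as (_ & E3 & E4).
        destruct (Hlip z v u v (Rabs (z - u)) Hz Huv) as [M1 M2];
          [lra | rewrite Rminus_diag, Rabs_R0; apply Rabs_pos |].
        rewrite E1, E2, E3, E4. repeat split; auto; ring.
      + split.
        * replace (Q2 (a u v) (b u v)) with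
            (Q2 (a u v) (b u v) * 1 - Q1 (a u v) (b u v) * 0) at 1 by ring. exact G1.
        * replace (- P2 (a u v) (b u v)) with
            (P1 (a u v) (b u v) * 0 - P2 (a u v) (b u v) * 1) by ring. exact G2.
    - destruct (inverse_is_derive s t (fun z => a u z) (fun z => b u z) v
        _ _ _ _ 0 1 (2 * A) Ds Dt (Hdet _ _ HDuv)) as [G1 G2]; [lra| |].
      + apply filter_imp with (2 := open_slice2 V u v HVo Huv). intros z Hz.
        destruct (Hab u z Hz) as (_ & E3 & E4).
        destruct (Hlip u z u v (Rabs (z - v)) Hz Huv) as [M1 M2];
          [rewrite Rminus_diag, Rabs_R0; apply Rabs_pos | lra |].
        rewrite E1, E2, E3, E4. repeat split; auto; ring.
      + split.
        * replace (- Q1 (a u v) (b u v)) with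
            (Q2 (a u v) (b u v) * 0 - Q1 (a u v) (b u v) * 1) by ring. exact G1.
        * replace (P1 (a u v) (b u v)) with
            (P1 (a u v) (b u v) * 1 - P2 (a u v) (b u v) * 0) at 1 by ring. exact G2. }
  assert (Hpa : partials V a (fun u v => Q2 (a u v) (b u v) / det (a u v) (b u v))
                 (fun u v => - Q1 (a u v) (b u v) / det (a u v) (b u v))).
  { intros u v Huv. destruct (Hpart u v Huv) as [[? ?] [? ?]]. split; assumption. }
  assert (Hpb : partials V b (fun u v => - P2 (a u v) (b u v) / det (a u v) (b u v))
                 (fun u v => P1 (a u v) (b u v) / det (a u v) (b u v))).
  { intros u v Huv. destruct (Hpart u v Huv) as [[? ?] [? ?]]. split; assumption. }
  assert (Hcont : forall c, (forall u v u' v' m, V (u, v) -> V (u', v') ->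
     Rabs (u - u') <= m -> Rabs (v - v') <= m ->
     Rabs (c u v - c u' v') <= 2 * A * m) -> Ck 0 V c).
  { intros c Hc. split; [|exact I]. intros u v Huv eps.
    destruct (open_locally_2d V u v HVo Huv) as [d Hd].
    assert (He : 0 < eps / (4 * A)) by (apply Rdiv_lt_0_compat; [apply cond_pos | lra]).
    assert (Hm : 0 < Rmin d (eps / (4 * A))) by (apply Rmin_case; [apply cond_pos | exact He]).
    exists (mkposreal _ Hm). simpl. intros u' v' Hu Hv.
    pose proof (Rmin_l d (eps / (4 * A))). pose proof (Rmin_r d (eps / (4 * A))).
    apply Rle_lt_trans with (2 * A * (eps / (4 * A))).
    - apply Hc; auto; [apply Hd|  |]; lra.
    - replace (2 * A * (eps / (4 * A))) with (eps / 2) by (field; lra).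
      pose proof (cond_pos eps). lra. }
  (* bootstrap: the partial derivatives of [(a, b)] are smooth functions of [(a, b)] *)
  assert (Hsm : forall n, Ck n V a /\ Ck n V b).
  { induction n as [|n [IHa IHb]].
    - split; apply Hcont; intros; eapply Hlip; eassumption.
    - assert (Hq : forall h, smooth2 D h ->
        Ck n V (fun u v => h (a u v) (b u v) / det (a u v) (b u v))).
      { intros h Hh. apply (Ck_comp n V D (fun x y => h x y * / det x y) a b); auto.
        apply smooth2_Ck; auto. apply smooth2_mult; auto. apply smooth2_inv; auto.
        unfold det. auto using smooth2_minus, smooth2_mult. }
      assert (Hneg : forall h, smooth2 D h -> smooth2 D (fun x y => - h x y)).
      { intros h Hh. apply smooth2_ext with (fun x y => -1 * h x y); auto.
        - intros; ring.
        - auto using smooth2_mult, smooth2_const. }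
      split.
      + eapply Ck_intro; [auto | exact Hpa | |].
        * apply Hq; auto.
        * apply (Hq (fun x y => - Q1 x y)); auto.
      + eapply Ck_intro; [auto | exact Hpb | |].
        * apply (Hq (fun x y => - P2 x y)); auto.
        * apply Hq; auto. }
  exists V, U, a, b. split; [apply square_domain, Hdelta|].
  split; [split; [apply square_center, Hr | apply square_center, Hdelta]|].
  split; [exact HUD|]. split; [|split; assumption].
  split; [exact HVo|]. split; [exact HUo|]. split; [|split].
  - split; apply smooth2_Ck; auto; intros n; apply Hsm.
  - intros u v Huv. destruct (Hab u v Huv) as (I1 & E1 & E2).
    split; [exact I1|]. simpl. rewrite E1, E2. exact Huv.
  - exists (fun x y => (s x y, t x y)). split; [|split; [|split]].
    + split; simpl; apply smooth2_restrict with D; auto.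
    + intros x y [_ HV]. exact HV.
    + intros u v Huv. simpl. destruct (Hab u v Huv) as (_ & E1 & E2). rewrite E1, E2. reflexivity.
    + intros x y [Hq HV]. simpl in *. destruct (Hab _ _ HV) as (I1 & E1 & E2).
      destruct (Hlipinv (a (s x y) (t x y)) (b (s x y) (t x y)) x y 0) as [G1 G2]; auto.
      * rewrite E1, Rminus_diag, Rabs_R0. lra.
      * rewrite E2, Rminus_diag, Rabs_R0. lra.
      * rewrite Rmult_0_r in G1, G2.
        assert (Hz : forall w, Rabs w <= 0 -> w = 0).
        { intros w Hw. destruct (Req_dec w 0) as [|Hne]; auto.
          pose proof (Rabs_pos_lt w Hne). lra. }
        apply Hz in G1, G2. f_equal; lra.
Qed.

(** * Linear algebra and surfaces in Minkowski space *)

(** The vector space operations of [R31]. *)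
Definition vadd (p q : R31) : R31 := (x1 p + x1 q, x2 p + x2 q, x3 p + x3 q).
Definition vscal (c : R) (p : R31) : R31 := (c * x1 p, c * x2 p, c * x3 p).

Lemma mink_comm p q : mink p q = mink q p.
Proof. unfold mink. ring. Qed.
Lemma mink_vadd_l p q w : mink (vadd p q) w = mink p w + mink q w.
Proof. unfold mink, vadd, x1, x2, x3; simpl. ring. Qed.
Lemma mink_vadd_r p q w : mink w (vadd p q) = mink w p + mink w q.
Proof. unfold mink, vadd, x1, x2, x3; simpl. ring. Qed.
Lemma mink_vscal_l c p w : mink (vscal c p) w = c * mink p w.
Proof. unfold mink, vscal, x1, x2, x3; simpl. ring. Qed.
Lemma mink_vscal_r c p w : mink w (vscal c p) = c * mink w p.
Proof. unfold mink, vscal, x1, x2, x3; simpl. ring. Qed.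

Ltac minks := rewrite ?mink_vadd_l, ?mink_vadd_r, ?mink_vscal_l, ?mink_vscal_r;
  rewrite ?mink_vadd_l, ?mink_vadd_r, ?mink_vscal_l, ?mink_vscal_r.

Lemma R31_eq (p q : R31) : x1 p = x1 q -> x2 p = x2 q -> x3 p = x3 q -> p = q.
Proof.
  destruct p as [[p1 p2] p3], q as [[q1 q2] q3]. unfold x1, x2, x3; simpl.
  intros; subst; reflexivity.
Qed.

(** A vector orthogonal to a basis consisting of two space-like tangent vectors
    and the time-like normal vanishes. *)
Lemma mink_nondegenerate X Y n v :
  0 < mink X X * mink Y Y - mink X Y ^ 2 ->
  mink n n = -1 -> mink n X = 0 -> mink n Y = 0 ->
  mink v X = 0 -> mink v Y = 0 -> mink v n = 0 -> v = (0, 0, 0).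
Proof.
  destruct X as [[X1 X2] X3], Y as [[Y1 Y2] Y3], n as [[n1 n2] n3], v as [[v1 v2] v3].
  unfold mink, x1, x2, x3; simpl fst; simpl snd. intros HG Hnn HnX HnY HvX HvY Hvn.
  set (d := X1 * (Y2 * n3 - Y3 * n2) - X2 * (Y1 * n3 - Y3 * n1) + X3 * (Y1 * n2 - Y2 * n1)).
  assert (Hd : d <> 0).
  { intros Hd0.
    (* the Gram determinant of the three vectors is [- d ^ 2] *)
    assert (E : d ^ 2 = - ((n1 * n1 + n2 * n2 - n3 * n3) *
        ((X1 * X1 + X2 * X2 - X3 * X3) * (Y1 * Y1 + Y2 * Y2 - Y3 * Y3)
          - (X1 * Y1 + X2 * Y2 - X3 * Y3) ^ 2)
        + 2 * (X1 * Y1 + X2 * Y2 - X3 * Y3) * (n1 * X1 + n2 * X2 - n3 * X3)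
            * (n1 * Y1 + n2 * Y2 - n3 * Y3)
        - (X1 * X1 + X2 * X2 - X3 * X3) * (n1 * Y1 + n2 * Y2 - n3 * Y3) ^ 2
        - (Y1 * Y1 + Y2 * Y2 - Y3 * Y3) * (n1 * X1 + n2 * X2 - n3 * X3) ^ 2))
      by (unfold d; ring).
    rewrite Hnn, HnX, HnY, Hd0 in E. lra. }
  (* Cramer's rule *)
  assert (E1 : d * v1 = 0).
  { replace (d * v1) with ((v1 * X1 + v2 * X2 - v3 * X3) * (Y2 * n3 - Y3 * n2)
      + (v1 * Y1 + v2 * Y2 - v3 * Y3) * (n2 * X3 - n3 * X2)
      + (v1 * n1 + v2 * n2 - v3 * n3) * (X2 * Y3 - X3 * Y2)) by (unfold d; ring).
    rewrite HvX, HvY, Hvn. ring. }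
  assert (E2 : d * v2 = 0).
  { replace (d * v2) with ((v1 * X1 + v2 * X2 - v3 * X3) * (Y3 * n1 - Y1 * n3)
      + (v1 * Y1 + v2 * Y2 - v3 * Y3) * (n3 * X1 - n1 * X3)
      + (v1 * n1 + v2 * n2 - v3 * n3) * (X3 * Y1 - X1 * Y3)) by (unfold d; ring).
    rewrite HvX, HvY, Hvn. ring. }
  assert (E3 : d * v3 = 0).
  { replace (d * v3) with (- ((v1 * X1 + v2 * X2 - v3 * X3) * (Y1 * n2 - Y2 * n1)
      + (v1 * Y1 + v2 * Y2 - v3 * Y3) * (n1 * X2 - n2 * X1)
      + (v1 * n1 + v2 * n2 - v3 * n3) * (X1 * Y2 - X2 * Y1))) by (unfold d; ring).
    rewrite HvX, HvY, Hvn. ring. }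
  apply Rmult_integral in E1, E2, E3.
  destruct E1 as [? | ->], E2 as [? | ->], E3 as [? | ->]; first [contradiction | reflexivity].
Qed.

Lemma posdef_det E F G :
  (forall a b, (a, b) <> (0, 0) -> 0 < E * a ^ 2 + 2 * F * a * b + G * b ^ 2) ->
  0 < E /\ 0 < E * G - F ^ 2.
Proof.
  intros H.
  assert (HE : 0 < E).
  { specialize (H 1 0). replace E with (E * 1 ^ 2 + 2 * F * 1 * 0 + G * 0 ^ 2) by ring.
    apply H. intros Hq; injection Hq; lra. }
  split; [exact HE|].
  assert (HF : 0 < E * (E * G - F ^ 2)).
  { replace (E * (E * G - F ^ 2)) with (E * (- F) ^ 2 + 2 * F * (- F) * E + G * E ^ 2) by ring.
    apply H. intros Hq; injection Hq; lra. }
  apply Rmult_lt_reg_l with E; [exact HE|]. lra.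
Qed.

(** [W] and [W'] are multiples, not both zero, of one space-like vector. *)
Definition spacelike_line (W W' : R31) : Prop :=
  exists T c c', 0 < mink T T /\ W = vscal c T /\ W' = vscal c' T /\ (c <> 0 \/ c' <> 0).

(** At a point where the shape operator has eigenvectors for [k1] and [k2], the
    vectors [dl + k2 dz] span the first principal line and the vectors
    [dl + k1 dz] the second one. *)
Lemma principal_lines X Y n nx ny k1 k2 a1 b1 a2 b2 :
  (forall a b, (a, b) <> (0, 0) ->
     0 < mink X X * a ^ 2 + 2 * mink X Y * a * b + mink Y Y * b ^ 2) ->
  mink n n = -1 -> mink n X = 0 -> mink n Y = 0 -> mink n nx = 0 -> mink n ny = 0 ->
  mink nx Y = mink ny X -> k1 <> k2 -> a1 * b2 - a2 * b1 <> 0 ->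
  - mink nx X * a1 + - mink ny X * b1 = k1 * (mink X X * a1 + mink X Y * b1) ->
  - mink ny X * a1 + - mink ny Y * b1 = k1 * (mink X Y * a1 + mink Y Y * b1) ->
  - mink nx X * a2 + - mink ny X * b2 = k2 * (mink X X * a2 + mink X Y * b2) ->
  - mink ny X * a2 + - mink ny Y * b2 = k2 * (mink X Y * a2 + mink Y Y * b2) ->
  let Wx := vadd nx (vscal k2 X) in let Wy := vadd ny (vscal k2 Y) in
  let Zx := vadd nx (vscal k1 X) in let Zy := vadd ny (vscal k1 Y) in
  spacelike_line Wx Wy /\ spacelike_line Zx Zy /\
  mink Wx Zx = 0 /\ mink Wx Zy = 0 /\ mink Wy Zx = 0 /\ mink Wy Zy = 0.
Proof.
  intros Hpd Hnn HnX HnY Hnx Hny Hsym Hk Hdet E11 E12 E21 E22 Wx Wy Zx Zy.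
  destruct (posdef_det _ _ _ Hpd) as [_ HG].
  pose proof (mink_comm X Y) as HXY.
  set (T1 := vadd (vscal a1 X) (vscal b1 Y)). set (T2 := vadd (vscal a2 X) (vscal b2 Y)).
  (* an eigenvector for [k] is in the kernel of [dl + k dz] *)
  assert (N1 : vadd (vscal a1 Zx) (vscal b1 Zy) = (0, 0, 0)).
  { apply (mink_nondegenerate X Y n); auto; unfold Zx, Zy; minks.
    - rewrite <- HXY. lra.
    - rewrite Hsym. lra.
    - rewrite (mink_comm nx), (mink_comm ny), (mink_comm X n), (mink_comm Y n),
        Hnx, Hny, HnX, HnY. ring. }
  assert (N2 : vadd (vscal a2 Wx) (vscal b2 Wy) = (0, 0, 0)).
  { apply (mink_nondegenerate X Y n); auto; unfold Wx, Wy; minks.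
    - rewrite <- HXY. lra.
    - rewrite Hsym. lra.
    - rewrite (mink_comm nx), (mink_comm ny), (mink_comm X n), (mink_comm Y n),
        Hnx, Hny, HnX, HnY. ring. }
  assert (HT : forall a b, (a, b) <> (0, 0) ->
    0 < mink (vadd (vscal a X) (vscal b Y)) (vadd (vscal a X) (vscal b Y))).
  { intros a b Hab. minks. rewrite (mink_comm Y X). specialize (Hpd a b Hab). lra. }
  assert (HT1 : 0 < mink T1 T1).
  { apply HT. intros Hq; injection Hq as -> ->. apply Hdet. ring. }
  assert (HT2 : 0 < mink T2 T2).
  { apply HT. intros Hq; injection Hq as -> ->. apply Hdet. ring. }
  (* eigenvectors of a symmetric form for different eigenvalues *)
  assert (HT12 : mink T1 T2 = 0).
  { assert (E : (k1 - k2) * mink T1 T2 = 0).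
    { unfold T1, T2. minks. rewrite (mink_comm Y X).
      replace ((k1 - k2) * _) with
        (a2 * (k1 * (mink X X * a1 + mink X Y * b1))
         + b2 * (k1 * (mink X Y * a1 + mink Y Y * b1))
         - a1 * (k2 * (mink X X * a2 + mink X Y * b2))
         - b1 * (k2 * (mink X Y * a2 + mink Y Y * b2))) by ring.
      rewrite <- E11, <- E12, <- E21, <- E22. ring. }
    apply Rmult_integral in E. destruct E; [lra | assumption]. }
  (* two linear equations for the pair of vectors [p], [q] *)
  assert (Hsolve : forall p q ax bx ay by0 d, ax * by0 - ay * bx = d -> d <> 0 ->
     forall T k, vadd (vscal ay p) (vscal by0 q) = (0, 0, 0) ->
     vadd (vscal ax p) (vscal bx q) = vscal k T ->
     p = vscal (by0 * k / d) T /\ q = vscal (- ay * k / d) T).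
  { intros p q ax bx ay by0 d Hd Hd0 T k F1 F2.
    unfold vadd, vscal, x1, x2, x3 in F1, F2. injection F1 as F11 F12 F13.
    injection F2 as F21 F22 F23.
    split; apply R31_eq; unfold vscal, x1, x2, x3; simpl;
      apply Rmult_eq_reg_l with d; auto.
    - transitivity (by0 * (k * fst (fst T))); [|field; auto].
      rewrite <- F21, <- Hd.
      transitivity (ax * by0 * fst (fst p) - bx * (ay * fst (fst p))); [ring|].
      replace (ay * fst (fst p)) with (- (by0 * fst (fst q))) by lra. ring.
    - transitivity (by0 * (k * snd (fst T))); [|field; auto].
      rewrite <- F22, <- Hd.
      transitivity (ax * by0 * snd (fst p) - bx * (ay * snd (fst p))); [ring|].
      replace (ay * snd (fst p)) with (- (by0 * snd (fst q))) by lra. ring.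
    - transitivity (by0 * (k * snd T)); [|field; auto].
      rewrite <- F23, <- Hd.
      transitivity (ax * by0 * snd p - bx * (ay * snd p)); [ring|].
      replace (ay * snd p) with (- (by0 * snd q)) by lra. ring.
    - transitivity (- ay * (k * fst (fst T))); [|field; auto].
      rewrite <- F21, <- Hd.
      transitivity (ax * (by0 * fst (fst q)) - ay * bx * fst (fst q)); [ring|].
      replace (by0 * fst (fst q)) with (- (ay * fst (fst p))) by lra. ring.
    - transitivity (- ay * (k * snd (fst T))); [|field; auto].
      rewrite <- F22, <- Hd.
      transitivity (ax * (by0 * snd (fst q)) - ay * bx * snd (fst q)); [ring|].
      replace (by0 * snd (fst q)) with (- (ay * snd (fst p))) by lra. ring.
    - transitivity (- ay * (k * snd T)); [|field; auto].
      rewrite <- F23, <- Hd.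
      transitivity (ax * (by0 * snd q) - ay * bx * snd q); [ring|].
      replace (by0 * snd q) with (- (ay * snd p)) by lra. ring. }
  assert (M1 : vadd (vscal a1 Wx) (vscal b1 Wy) = vscal (k2 - k1) T1).
  { transitivity (vadd (vadd (vscal a1 Zx) (vscal b1 Zy)) (vscal (k2 - k1) T1)).
    - apply R31_eq; unfold Wx, Wy, Zx, Zy, T1, vadd, vscal, x1, x2, x3; simpl; ring.
    - rewrite N1. apply R31_eq; unfold vadd, x1, x2, x3; simpl; ring. }
  assert (M2 : vadd (vscal a2 Zx) (vscal b2 Zy) = vscal (k1 - k2) T2).
  { transitivity (vadd (vadd (vscal a2 Wx) (vscal b2 Wy)) (vscal (k1 - k2) T2)).
    - apply R31_eq; unfold Wx, Wy, Zx, Zy, T2, vadd, vscal, x1, x2, x3; simpl; ring.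
    - rewrite N2. apply R31_eq; unfold vadd, x1, x2, x3; simpl; ring. }
  destruct (Hsolve _ _ a1 b1 a2 b2 _ eq_refl Hdet T1 _ N2 M1) as [EWx EWy].
  destruct (Hsolve _ _ a2 b2 a1 b1 (a2 * b1 - a1 * b2) eq_refl ltac:(lra) T2 _ N1 M2)
    as [EZx EZy].
  assert (Hnz : forall k d, k <> 0 -> d <> 0 -> forall b, b <> 0 -> b * k / d <> 0).
  { intros k d Hk0 Hd0 b Hb. apply Rmult_integral_contrapositive_currified;
      [apply Rmult_integral_contrapositive_currified | apply Rinv_neq_0_compat]; auto. }
  split; [|split].
  - exists T1, (b2 * (k2 - k1) / (a1 * b2 - a2 * b1)), (- a2 * (k2 - k1) / (a1 * b2 - a2 * b1)).
    split; [exact HT1|]. split; [exact EWx|]. split; [exact EWy|].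
    destruct (Req_dec b2 0) as [Hb|Hb].
    + right. apply Hnz; [lra | lra |]. intros Ha. apply Hdet. rewrite Hb.
      replace a2 with 0 by lra. ring.
    + left. apply Hnz; lra.
  - exists T2, (b1 * (k1 - k2) / (a2 * b1 - a1 * b2)), (- a1 * (k1 - k2) / (a2 * b1 - a1 * b2)).
    split; [exact HT2|]. split; [exact EZx|]. split; [exact EZy|].
    destruct (Req_dec b1 0) as [Hb|Hb].
    + right. apply Hnz; [lra | lra |]. intros Ha. apply Hdet. rewrite Hb.
      replace a1 with 0 by lra. ring.
    + left. apply Hnz; lra.
  - rewrite EWx, EWy, EZx, EZy. minks. rewrite HT12. repeat split; ring.
Qed.

Lemma smooth2_R31_restrict (D D' : R * R -> Prop) w :
  (forall q, D' q -> D q) -> smooth2_R31 D w -> smooth2_R31 D' w.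
Proof. intros HD (H1 & H2 & H3). repeat split; apply smooth2_restrict with D; auto. Qed.

Lemma smooth2_du3 (D : R * R -> Prop) w : smooth2_R31 D w -> smooth2_R31 D (du3 w).
Proof.
  intros (H1 & H2 & H3).
  split; [|split]; [exact (smooth2_du _ _ H1) | exact (smooth2_du _ _ H2) | exact (smooth2_du _ _ H3)].
Qed.

Lemma smooth2_dv3 (D : R * R -> Prop) w : smooth2_R31 D w -> smooth2_R31 D (dv3 w).
Proof.
  intros (H1 & H2 & H3).
  split; [|split]; [exact (smooth2_dv _ _ H1) | exact (smooth2_dv _ _ H2) | exact (smooth2_dv _ _ H3)].
Qed.

Lemma smooth2_vscal (D : R * R -> Prop) h w :
  open D -> smooth2 D h -> smooth2_R31 D w -> smooth2_R31 D (fun x y => vscal (h x y) (w x y)).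
Proof.
  intros HD Hh (H1 & H2 & H3). unfold vscal, x1, x2, x3; simpl.
  split; [|split]; apply smooth2_mult; auto.
Qed.

Lemma smooth2_vadd (D : R * R -> Prop) w w' :
  open D -> smooth2_R31 D w -> smooth2_R31 D w' ->
  smooth2_R31 D (fun x y => vadd (w x y) (w' x y)).
Proof.
  intros HD (H1 & H2 & H3) (H1' & H2' & H3'). unfold vadd, x1, x2, x3; simpl.
  split; [|split]; apply smooth2_plus; auto.
Qed.

Lemma smooth2_mink (D : R * R -> Prop) w w' :
  open D -> smooth2_R31 D w -> smooth2_R31 D w' ->
  smooth2 D (fun x y => mink (w x y) (w' x y)).
Proof.
  intros HD (H1 & H2 & H3) (H1' & H2' & H3'). unfold mink.
  apply smooth2_minus; auto. apply smooth2_plus; auto.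
  all: apply smooth2_mult; auto.
Qed.

Lemma du3_Schwarz (D : R * R -> Prop) w x y :
  open D -> smooth2_R31 D w -> D (x, y) -> du3 (dv3 w) x y = dv3 (du3 w) x y.
Proof.
  intros HD (H1 & H2 & H3) Hxy. apply R31_eq.
  - exact (smooth2_Schwarz D (fun s t => x1 (w s t)) x y HD H1 Hxy).
  - exact (smooth2_Schwarz D (fun s t => x2 (w s t)) x y HD H2 Hxy).
  - exact (smooth2_Schwarz D (fun s t => x3 (w s t)) x y HD H3 Hxy).
Qed.

(** The Leibniz rule for the scalar product. *)
Lemma partials_mink (D : R * R -> Prop) w w' :
  smooth2_R31 D w -> smooth2_R31 D w' ->
  partials D (fun x y => mink (w x y) (w' x y))
    (fun x y => mink (du3 w x y) (w' x y) + mink (w x y) (du3 w' x y))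
    (fun x y => mink (dv3 w x y) (w' x y) + mink (w x y) (dv3 w' x y)).
Proof.
  intros (H1 & H2 & H3) (H1' & H2' & H3') x y Hxy.
  destruct (smooth2_partials _ _ H1 x y Hxy) as [A1 B1].
  destruct (smooth2_partials _ _ H2 x y Hxy) as [A2 B2].
  destruct (smooth2_partials _ _ H3 x y Hxy) as [A3 B3].
  destruct (smooth2_partials _ _ H1' x y Hxy) as [A1' B1'].
  destruct (smooth2_partials _ _ H2' x y Hxy) as [A2' B2'].
  destruct (smooth2_partials _ _ H3' x y Hxy) as [A3' B3'].
  assert (Hgen : forall (f1 f2 f3 g1 g2 g3 : R -> R) z df1 df2 df3 dg1 dg2 dg3,
    is_derive f1 z df1 -> is_derive f2 z df2 -> is_derive f3 z df3 ->
    is_derive g1 z dg1 -> is_derive g2 z dg2 -> is_derive g3 z dg3 ->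
    is_derive (fun t => f1 t * g1 t + f2 t * g2 t - f3 t * g3 t) z
     ((df1 * g1 z + df2 * g2 z - df3 * g3 z) + (f1 z * dg1 + f2 z * dg2 - f3 z * dg3))).
  { intros f1 f2 f3 g1 g2 g3 z df1 df2 df3 dg1 dg2 dg3 F1 F2 F3 G1 G2 G3.
    replace (_ + _) with (((df1 * g1 z + f1 z * dg1) + (df2 * g2 z + f2 z * dg2))
      - (df3 * g3 z + f3 z * dg3)) by ring.
    apply @is_derive_minus; [apply @is_derive_plus|];
      apply @is_derive_mult; auto; apply Rmult_comm. }
  split; unfold mink.
  - apply (Hgen (fun t => x1 (w t y)) (fun t => x2 (w t y)) (fun t => x3 (w t y))
      (fun t => x1 (w' t y)) (fun t => x2 (w' t y)) (fun t => x3 (w' t y))); assumption.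
  - apply (Hgen (fun t => x1 (w x t)) (fun t => x2 (w x t)) (fun t => x3 (w x t))
      (fun t => x1 (w' x t)) (fun t => x2 (w' x t)) (fun t => x3 (w' x t))); assumption.
Qed.

Lemma partials_constant (D : R * R -> Prop) h hx hy c :
  open D -> partials D h hx hy -> (forall x y, D (x, y) -> h x y = c) ->
  forall x y, D (x, y) -> hx x y = 0 /\ hy x y = 0.
Proof.
  intros HD Hp Hc x y Hxy.
  pose proof (partials_ext D h (fun _ _ => c) hx hy HD Hc Hp x y Hxy) as [H1 H2].
  apply is_derive_unique in H1, H2. rewrite Derive_const in H1, H2. auto.
Qed.

Lemma mink_constant (D : R * R -> Prop) w w' c :
  open D -> smooth2_R31 D w -> smooth2_R31 D w' ->
  (forall x y, D (x, y) -> mink (w x y) (w' x y) = c) ->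
  forall x y, D (x, y) ->
    mink (du3 w x y) (w' x y) + mink (w x y) (du3 w' x y) = 0 /\
    mink (dv3 w x y) (w' x y) + mink (w x y) (dv3 w' x y) = 0.
Proof.
  intros HD Hw Hw' Hc. exact (partials_constant D _ _ _ c HD (partials_mink D w w' Hw Hw') Hc).
Qed.

(** The coefficients of the second fundamental form in terms of the
    derivatives of the normal. *)
Lemma second_form S :
  open (dom S) -> smooth2_R31 (dom S) (Defs.pos S) -> smooth2_R31 (dom S) (nrm S) ->
  (forall u v, dom S (u, v) ->
     mink (nrm S u v) (du3 (Defs.pos S) u v) = 0 /\ mink (nrm S u v) (dv3 (Defs.pos S) u v) = 0) ->
  forall u v, dom S (u, v) ->
    cL S u v = - mink (du3 (nrm S) u v) (du3 (Defs.pos S) u v) /\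
    cM S u v = - mink (dv3 (nrm S) u v) (du3 (Defs.pos S) u v) /\
    cM S u v = - mink (du3 (nrm S) u v) (dv3 (Defs.pos S) u v) /\
    cN S u v = - mink (dv3 (nrm S) u v) (dv3 (Defs.pos S) u v).
Proof.
  intros HD Hz Hl Ho u v Huv.
  destruct (mink_constant (dom S) (nrm S) (du3 (Defs.pos S)) 0 HD Hl (smooth2_du3 _ _ Hz)
    (fun x y H => proj1 (Ho x y H)) u v Huv) as [E1 E2].
  destruct (mink_constant (dom S) (nrm S) (dv3 (Defs.pos S)) 0 HD Hl (smooth2_dv3 _ _ Hz)
    (fun x y H => proj2 (Ho x y H)) u v Huv) as [E3 E4].
  rewrite (du3_Schwarz (dom S)) in E3 by assumption.
  unfold cL, cM, cN. repeat split; lra.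
Qed.

(** Normalizing a smooth family of space-like lines. *)
Lemma smooth_unit_vector (D : R * R -> Prop) W W' x0 y0 :
  open D -> D (x0, y0) -> smooth2_R31 D W -> smooth2_R31 D W' ->
  (forall x y, D (x, y) -> spacelike_line (W x y) (W' x y)) ->
  exists r e, 0 < r /\ (forall q, square x0 y0 r q -> D q) /\
    smooth2_R31 (square x0 y0 r) e /\
    forall x y, square x0 y0 r (x, y) -> mink (e x y) (e x y) = 1 /\
      (exists c, W x y = vscal c (e x y)) /\ (exists c, W' x y = vscal c (e x y)) /\
      (exists c c', e x y = vadd (vscal c (W x y)) (vscal c' (W' x y))).
Proof.
  intros HD H0 HW HW' Hl.
  assert (Hgen : forall w w', smooth2_R31 D w -> smooth2_R31 D w' ->
    (forall x y, D (x, y) -> spacelike_line (w x y) (w' x y)) ->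
    mink (w x0 y0) (w x0 y0) <> 0 ->
    exists r e, 0 < r /\ (forall q, square x0 y0 r q -> D q) /\
    smooth2_R31 (square x0 y0 r) e /\
    forall x y, square x0 y0 r (x, y) -> mink (e x y) (e x y) = 1 /\
      (exists c, w x y = vscal c (e x y)) /\ (exists c, w' x y = vscal c (e x y)) /\
      (exists c, e x y = vscal c (w x y))).
  { intros w w' Hw Hw' Hlw Hne.
    pose proof (smooth2_mink D w w HD Hw Hw) as Hs.
    destruct (continuity_2d_pt_neq_0 _ _ _ (smooth2_cont _ _ _ _ Hs H0) Hne) as [d Hd].
    destruct (open_square D x0 y0 HD H0) as [r0 [Hr0 HrD]].
    exists (Rmin d r0).
    assert (Hpos : forall x y, square x0 y0 (Rmin d r0) (x, y) ->
      D (x, y) /\ 0 < mink (w x y) (w x y)).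
    { intros x y Hxy. assert (Dxy : D (x, y)).
      { apply HrD. apply square_le with (2 := Hxy). apply Rmin_r. }
      split; [exact Dxy|].
      assert (N : mink (w x y) (w x y) <> 0).
      { destruct (square_le _ _ _ d _ (Rmin_l d r0) Hxy). apply Hd; assumption. }
      destruct (Hlw x y Dxy) as (T & c & c' & HT & E & _). rewrite E in N |- *.
      revert N. minks. intros N. assert (c <> 0) by (intros ->; apply N; ring).
      rewrite <- Rmult_assoc. apply Rmult_lt_0_compat; auto. nra. }
    exists (fun x y => vscal (/ sqrt (mink (w x y) (w x y))) (w x y)).
    split; [apply Rmin_case; [apply cond_pos | exact Hr0]|].
    split; [intros [x y] Hxy; apply Hpos, Hxy|].
    assert (Hsq : forall x y, square x0 y0 (Rmin d r0) (x, y) ->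
      0 < sqrt (mink (w x y) (w x y))) by (intros x y Hxy; apply sqrt_lt_R0, Hpos, Hxy).
    split.
    - apply smooth2_vscal; [apply square_open | |].
      + apply smooth2_inv; [apply square_open | |].
        * intros x y Hxy. apply Rgt_not_eq, Hsq, Hxy.
        * apply smooth2_sqrt; [apply square_open | intros; apply Hpos; auto |].
          apply smooth2_restrict with D; auto. intros [x y] Hxy. apply Hpos, Hxy.
      + apply smooth2_R31_restrict with D; auto. intros [x y] Hxy. apply Hpos, Hxy.
    - intros x y Hxy. destruct (Hpos x y Hxy) as [Dxy Hp]. pose proof (Hsq x y Hxy) as Hq.
      set (k := sqrt (mink (w x y) (w x y))) in *.
      assert (Ew : w x y = vscal k (vscal (/ k) (w x y))).
      { apply R31_eq; unfold vscal, x1, x2, x3; simpl; field; lra. }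
      split; [|split; [|split]].
      + minks. replace (mink (w x y) (w x y)) with (k * k) by (apply sqrt_sqrt; lra).
        field. lra.
      + exists k. exact Ew.
      + destruct (Hlw x y Dxy) as (T & c & c' & HT & E & E' & _).
        assert (Hc : c <> 0).
        { intros ->. rewrite E in Hp. revert Hp. minks. lra. }
        exists (c' / c * k). rewrite E'.
        transitivity (vscal (c' / c) (w x y)).
        * rewrite E. apply R31_eq; unfold vscal, x1, x2, x3; simpl; field; auto.
        * apply R31_eq; unfold vscal, x1, x2, x3; simpl; field; lra.
      + exists (/ k). reflexivity. }
  assert (Hor : mink (W x0 y0) (W x0 y0) <> 0 \/ mink (W' x0 y0) (W' x0 y0) <> 0).
  { destruct (Hl x0 y0 H0) as (T & c & c' & HT & E & E' & [Hc|Hc]); [left; rewrite E | right; rewrite E'];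
      minks; repeat apply Rmult_integral_contrapositive_currified; auto; lra. }
  destruct Hor as [Hne|Hne].
  - destruct (Hgen W W' HW HW' Hl Hne) as (r & e & Hr & HrD & He & Hp).
    exists r, e. split; [exact Hr|]. split; [exact HrD|]. split; [exact He|].
    intros x y Hxy. destruct (Hp x y Hxy) as (E1 & E2 & E3 & [c E4]).
    repeat split; auto. exists c, 0. rewrite E4 at 1.
    apply R31_eq; unfold vadd, vscal, x1, x2, x3; simpl; ring.
  - destruct (Hgen W' W) as (r & e & Hr & HrD & He & Hp); auto.
    { intros x y Hxy. destruct (Hl x y Hxy) as (T & c & c' & ? & ? & ? & ?).
      exists T, c', c. tauto. }
    exists r, e. split; [exact Hr|]. split; [exact HrD|]. split; [exact He|].
    intros x y Hxy. destruct (Hp x y Hxy) as (E1 & E2 & E3 & [c E4]).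
    repeat split; auto. exists 0, c. rewrite E4 at 1.
    apply R31_eq; unfold vadd, vscal, x1, x2, x3; simpl; ring.
Qed.

(** The Codazzi equation: the form [exp A (dz . e)] is closed, where [e] is the
    unit principal direction for [F], [G] is the other principal curvature and
    [dA = dF / (F - G)]. *)
Lemma Codazzi_closed (D : R * R -> Prop) z l e F G A :
  open D -> smooth2_R31 D z -> smooth2_R31 D l -> smooth2_R31 D e ->
  smooth2 D F -> (forall x y, D (x, y) -> F x y - G x y <> 0) ->
  partials D A (fun x y => du F x y / (F x y - G x y)) (fun x y => dv F x y / (F x y - G x y)) ->
  (forall x y, D (x, y) -> mink (e x y) (e x y) = 1 /\
     mink (vadd (du3 l x y) (vscal (F x y) (du3 z x y))) (e x y) = 0 /\
     mink (vadd (dv3 l x y) (vscal (F x y) (dv3 z x y))) (e x y) = 0 /\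
     (exists c, vadd (du3 l x y) (vscal (G x y) (du3 z x y)) = vscal c (e x y)) /\
     (exists c, vadd (dv3 l x y) (vscal (G x y) (dv3 z x y)) = vscal c (e x y))) ->
  forall x y, D (x, y) ->
    dv (fun x y => exp (A x y) * mink (du3 z x y) (e x y)) x y =
    du (fun x y => exp (A x y) * mink (dv3 z x y) (e x y)) x y.
Proof.
  intros HD Hz Hl He HF HFG HA Hpt.
  pose proof (smooth2_du3 _ _ Hz) as Hzx. pose proof (smooth2_dv3 _ _ Hz) as Hzy.
  pose proof (smooth2_du3 _ _ Hl) as Hlx. pose proof (smooth2_dv3 _ _ Hl) as Hly.
  pose proof (smooth2_partials _ _ HF) as HFp.
  assert (HeA : partials D (fun x y => exp (A x y))
    (fun x y => du F x y / (F x y - G x y) * exp (A x y))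
    (fun x y => dv F x y / (F x y - G x y) * exp (A x y))).
  { intros x y Hxy. destruct (HA x y Hxy). split.
    - apply (is_derive_comp exp (fun t => A t y)); auto. apply is_derive_exp.
    - apply (is_derive_comp exp (fun t => A x t)); auto. apply is_derive_exp. }
  intros x y Hxy.
  rewrite (partials_dv D _ _ _ x y (partials_mult D _ _ _ _ _ _ HeA (partials_mink D _ _ Hzx He)) Hxy).
  rewrite (partials_du D _ _ _ x y (partials_mult D _ _ _ _ _ _ HeA (partials_mink D _ _ Hzy He)) Hxy).
  destruct (partials_constant D _ _ _ 0 HD (partials_plus D _ _ _ _ _ _
    (partials_mink D _ _ Hlx He) (partials_mult D _ _ _ _ _ _ HFp (partials_mink D _ _ Hzx He))))
    with (x := x) (y := y) as [_ E1]; auto.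
  { intros s t Hst. destruct (Hpt s t Hst) as (_ & E & _). revert E. minks. auto. }
  destruct (partials_constant D _ _ _ 0 HD (partials_plus D _ _ _ _ _ _
    (partials_mink D _ _ Hly He) (partials_mult D _ _ _ _ _ _ HFp (partials_mink D _ _ Hzy He))))
    with (x := x) (y := y) as [E2 _]; auto.
  { intros s t Hst. destruct (Hpt s t Hst) as (_ & _ & E & _). revert E. minks. auto. }
  destruct (mink_constant D e e 1 HD He He (fun s t H => proj1 (Hpt s t H)) x y Hxy) as [U1 U2].
  rewrite (mink_comm (du3 e x y)) in U1. rewrite (mink_comm (dv3 e x y)) in U2.
  destruct (Hpt x y Hxy) as (_ & _ & _ & [c Ec] & [c' Ec']).
  assert (V1 : mink (du3 l x y) (dv3 e x y) + G x y * mink (du3 z x y) (dv3 e x y) = 0).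
  { transitivity (mink (vadd (du3 l x y) (vscal (G x y) (du3 z x y))) (dv3 e x y)).
    - minks. ring.
    - rewrite Ec. minks. replace (mink (e x y) (dv3 e x y)) with 0 by lra. ring. }
  assert (V2 : mink (dv3 l x y) (du3 e x y) + G x y * mink (dv3 z x y) (du3 e x y) = 0).
  { transitivity (mink (vadd (dv3 l x y) (vscal (G x y) (dv3 z x y))) (du3 e x y)).
    - minks. ring.
    - rewrite Ec'. minks. replace (mink (e x y) (du3 e x y)) with 0 by lra. ring. }
  rewrite (du3_Schwarz D l) in E2 by assumption. rewrite (du3_Schwarz D z) in E2 |- * by assumption.
  pose proof (HFG x y Hxy) as Hne.
  (* difference of the two equations obtained by differentiating
     [(l_x + F z_x) . e = 0] in [y] and [(l_y + F z_y) . e = 0] in [x] *)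
  assert (K : dv F x y * mink (du3 z x y) (e x y) - du F x y * mink (dv3 z x y) (e x y) =
    (F x y - G x y) * (mink (dv3 z x y) (du3 e x y) - mink (du3 z x y) (dv3 e x y))) by lra.
  apply Rmult_eq_reg_l with (F x y - G x y); auto.
  apply Rminus_diag_uniq.
  match goal with |- ?lhs = 0 => transitivity (exp (A x y) *
    ((dv F x y * mink (du3 z x y) (e x y) - du F x y * mink (dv3 z x y) (e x y)) -
    (F x y - G x y) * (mink (dv3 z x y) (du3 e x y) - mink (du3 z x y) (dv3 e x y)))) end.
  - field. exact Hne.
  - rewrite K. ring.
Qed.

(** * The integrals I and J, and orthonormal frames *)

(** The integrand is continuous on a neighbourhood of every point of [K], so the
    two-sided derivative exists also at an endpoint of [K]. *)
Lemma is_derive_int_I (K : R -> Prop) f g nu0 t :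
  is_connected K -> smooth1 K f -> smooth1 K g ->
  (forall t, K t -> f t - g t <> 0) -> K nu0 -> K t ->
  is_derive (int_I f g nu0) t (Derive f t / (f t - g t)).
Proof.
  intros HK Hf Hg Hfg H0 Ht.
  set (h := fun t => Derive f t / (f t - g t)).
  assert (Hcont : forall F s, (forall n, ex_derive_n F n s) -> continuous F s /\ continuous (Derive F) s).
  { intros F s HF. split; apply (@ex_derive_continuous R_AbsRing R_NormedModule).
    - exact (HF 1%nat).
    - exact (HF 2%nat). }
  assert (Hh : forall s, (forall n, ex_derive_n f n s) -> (forall n, ex_derive_n g n s) ->
    f s - g s <> 0 -> continuous h s).
  { intros s Fs Gs Hne. destruct (Hcont f s Fs) as [C1 C2], (Hcont g s Gs) as [C3 _].
    apply (continuous_mult (Derive f) (fun t => / (f t - g t))); [exact C2|].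
    apply continuous_comp; [apply @continuous_minus; assumption|].
    apply continuity_pt_filterlim. apply (continuity_pt_inv (fun x => x)); [|exact Hne].
    apply continuity_pt_id. }
  assert (Hloc : forall s, K s -> locally s (fun w => continuous h w)).
  { intros s Hs.
    assert (Cfg : continuous (fun t => f t - g t) s).
    { apply @continuous_minus; apply Hcont.
      - exact (locally_singleton _ _ (Hf s Hs)).
      - exact (locally_singleton _ _ (Hg s Hs)). }
    assert (Hne : locally s (fun w => f w - g w <> 0)).
    { apply (Cfg (fun y => y <> 0)). apply open_neq. apply Hfg, Hs. }
    generalize (filter_and _ _ (Hf s Hs) (filter_and _ _ (Hg s Hs) Hne)).
    apply filter_imp. intros w (A1 & A2 & A3). apply Hh; assumption. }
  assert (Hex : ex_RInt h nu0 t).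
  { apply @ex_RInt_continuous. intros w Hw. apply (locally_singleton _ _ (Hloc w
      ltac:(revert Hw; unfold Rmin, Rmax; destruct (Rle_dec nu0 t); intros;
        [apply (HK nu0 t) | apply (HK t nu0)]; auto))). }
  apply (is_derive_RInt h (int_I f g nu0) nu0 t).
  - destruct (Hloc t Ht) as [d Hd]. exists d. intros w Hw.
    apply (RInt_correct h nu0 w). apply ex_RInt_Chasles with t; [exact Hex|].
    apply @ex_RInt_continuous. intros s Hs. apply Hd.
    apply (Rabs_segment t w); auto.
  - exact (locally_singleton _ _ (Hloc t Ht)).
Qed.

(** [d(I(nu)) = d(f(nu)) / (f(nu) - g(nu))]. *)
Lemma int_I_partials (D : R * R -> Prop) (K : R -> Prop) f g nu nu0 :
  is_connected K -> smooth1 K f -> smooth1 K g ->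
  (forall t, K t -> f t - g t <> 0) -> K nu0 ->
  smooth2 D nu -> (forall x y, D (x, y) -> K (nu x y)) ->
  partials D (fun x y => int_I f g nu0 (nu x y))
    (fun x y => du (fun x y => f (nu x y)) x y / (f (nu x y) - g (nu x y)))
    (fun x y => dv (fun x y => f (nu x y)) x y / (f (nu x y) - g (nu x y))).
Proof.
  intros HK Hf Hg Hfg H0 Hnu HKn x y Hxy.
  pose proof (HKn x y Hxy) as Kxy. pose proof (Hfg _ Kxy) as Hne.
  destruct (smooth2_partials D nu Hnu x y Hxy) as [N1 N2].
  pose proof (is_derive_int_I K f g nu0 _ HK Hf Hg Hfg H0 Kxy) as HI.
  assert (Hfd : is_derive f (nu x y) (Derive f (nu x y))).
  { apply Derive_correct. exact (locally_singleton _ _ (Hf _ Kxy) 1%nat). }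
  split.
  - replace (du (fun x y => f (nu x y)) x y) with (du nu x y * Derive f (nu x y)).
    + replace (_ / _) with (du nu x y * (Derive f (nu x y) / (f (nu x y) - g (nu x y))))
        by (field; auto).
      apply (is_derive_comp (int_I f g nu0) (fun t => nu t y)); assumption.
    + symmetry. apply is_derive_unique. apply (is_derive_comp f (fun t => nu t y)); assumption.
  - replace (dv (fun x y => f (nu x y)) x y) with (dv nu x y * Derive f (nu x y)).
    + replace (_ / _) with (dv nu x y * (Derive f (nu x y) / (f (nu x y) - g (nu x y))))
        by (field; auto).
      apply (is_derive_comp (int_I f g nu0) (fun t => nu x t)); assumption.
    + symmetry. apply is_derive_unique. apply (is_derive_comp f (fun t => nu x t)); assumption.
Qed.

Lemma vsub_zero p q : vadd p (vscal (-1) q) = (0, 0, 0) -> p = q.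
Proof.
  destruct p as [[p1 p2] p3], q as [[q1 q2] q3]. unfold vadd, vscal, x1, x2, x3; simpl.
  intros E. injection E as E1 E2 E3. f_equal; [f_equal|]; lra.
Qed.

(** A tangent vector is the sum of its components along an orthonormal tangent
    frame. *)
Lemma frame_expansion e1 e2 n X :
  mink e1 e1 = 1 -> mink e2 e2 = 1 -> mink e1 e2 = 0 ->
  mink n n = -1 -> mink n e1 = 0 -> mink n e2 = 0 -> mink n X = 0 ->
  X = vadd (vscal (mink X e1) e1) (vscal (mink X e2) e2).
Proof.
  intros H11 H22 H12 Hnn Hn1 Hn2 HnX.
  set (w := vadd (vscal (mink X e1) e1) (vscal (mink X e2) e2)).
  assert (E : vadd X (vscal (-1) w) = (0, 0, 0)).
  { pose proof (mink_comm e2 e1).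
    apply (mink_nondegenerate e1 e2 n); auto; unfold w; minks.
    - rewrite H11, H22, H12. replace (1 * 1 - 0 ^ 2) with 1 by ring. lra.
    - rewrite H11, H, H12. ring.
    - rewrite H22, H12. ring.
    - rewrite (mink_comm X n), (mink_comm e1 n), (mink_comm e2 n), HnX, Hn1, Hn2. ring. }
  apply vsub_zero, E.
Qed.

(** The derivative of the normal in a principal frame. *)
Lemma shape_expansion e1 e2 n X nx k1 k2 :
  mink e1 e1 = 1 -> mink e2 e2 = 1 -> mink e1 e2 = 0 ->
  mink n n = -1 -> mink n e1 = 0 -> mink n e2 = 0 -> mink n X = 0 -> mink n nx = 0 ->
  mink (vadd nx (vscal k1 X)) e1 = 0 -> mink (vadd nx (vscal k2 X)) e2 = 0 ->
  nx = vadd (vscal (- k1 * mink X e1) e1) (vscal (- k2 * mink X e2) e2).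
Proof.
  intros H11 H22 H12 Hnn Hn1 Hn2 HnX Hnx E1 E2.
  rewrite mink_vadd_l, mink_vscal_l in E1, E2.
  rewrite (frame_expansion e1 e2 n nx) at 1; auto.
  f_equal; f_equal; lra.
Qed.

(** * Natural principal parameters *)

(** [e1 x y], [e2 x y] is an orthonormal frame of the tangent plane of [S] at
    [(x, y)], and these are principal directions for the principal curvatures
    [k1] and [k2]. *)
Definition principal_frame (S : surface) (k1 k2 : R) (e1 e2 : R31) (x y : R) : Prop :=
  mink e1 e1 = 1 /\ mink e2 e2 = 1 /\ mink e1 e2 = 0 /\
  mink (nrm S x y) e1 = 0 /\ mink (nrm S x y) e2 = 0 /\
  (let Wx k := vadd (du3 (nrm S) x y) (vscal k (du3 (Defs.pos S) x y)) in
   let Wy k := vadd (dv3 (nrm S) x y) (vscal k (dv3 (Defs.pos S) x y)) in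
   mink (Wx k1) e1 = 0 /\ mink (Wy k1) e1 = 0 /\
   mink (Wx k2) e2 = 0 /\ mink (Wy k2) e2 = 0 /\
   (exists c, Wx k2 = vscal c e1) /\ (exists c, Wy k2 = vscal c e1) /\
   (exists c, Wx k1 = vscal c e2) /\ (exists c, Wy k1 = vscal c e2)).

Lemma exists_principal_frame S K f g nu x0 y0 :
  weingarten S K f g nu -> dom S (x0, y0) ->
  exists r e1 e2, 0 < r /\ (forall q, square x0 y0 r q -> dom S q) /\
    smooth2_R31 (square x0 y0 r) e1 /\ smooth2_R31 (square x0 y0 r) e2 /\
    forall x y, square x0 y0 r (x, y) ->
      principal_frame S (f (nu x y)) (g (nu x y)) (e1 x y) (e2 x y) x y.
Proof.
  intros ((HdomS & Hz & Hl & Hsp) & HK & Hf & Hg & Hnu & Hfg & Hpc) H0.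
  destruct HdomS as [HD _].
  set (D := dom S) in *. set (z := Defs.pos S) in *. set (l := nrm S) in *.
  pose proof (smooth2_du3 _ _ Hz) as Hzx. pose proof (smooth2_dv3 _ _ Hz) as Hzy.
  pose proof (smooth2_du3 _ _ Hl) as Hlx. pose proof (smooth2_dv3 _ _ Hl) as Hly.
  assert (Hkf : smooth2 D (fun x y => f (nu x y))).
  { apply (smooth2_comp1_n D K f nu 0); auto. intros; apply Hpc; auto. }
  assert (Hkg : smooth2 D (fun x y => g (nu x y))).
  { apply (smooth2_comp1_n D K g nu 0); auto. intros; apply Hpc; auto. }
  set (Wx := fun x y => vadd (du3 l x y) (vscal (g (nu x y)) (du3 z x y))).
  set (Wy := fun x y => vadd (dv3 l x y) (vscal (g (nu x y)) (dv3 z x y))).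
  set (Zx := fun x y => vadd (du3 l x y) (vscal (f (nu x y)) (du3 z x y))).
  set (Zy := fun x y => vadd (dv3 l x y) (vscal (f (nu x y)) (dv3 z x y))).
  assert (Hnl : forall x y, D (x, y) -> mink (l x y) (du3 l x y) = 0 /\ mink (l x y) (dv3 l x y) = 0).
  { intros x y Hxy.
    destruct (mink_constant D l l (-1) HD Hl Hl) with (x := x) (y := y) as [E1 E2]; auto.
    - intros s t Hst. apply Hsp, Hst.
    - rewrite (mink_comm (du3 l x y)) in E1. rewrite (mink_comm (dv3 l x y)) in E2. lra. }
  assert (Hpt : forall x y, D (x, y) ->
     spacelike_line (Wx x y) (Wy x y) /\ spacelike_line (Zx x y) (Zy x y) /\
     mink (Wx x y) (Zx x y) = 0 /\ mink (Wx x y) (Zy x y) = 0 /\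
     mink (Wy x y) (Zx x y) = 0 /\ mink (Wy x y) (Zy x y) = 0).
  { intros x y Hxy.
    destruct (Hpc x y Hxy) as [HKn (a1 & b1 & a2 & b2 & Hdet & [E11 E12] & [E21 E22])].
    destruct (Hsp x y Hxy) as (Hpd & Hnn & HnX & HnY & _).
    destruct (Hnl x y Hxy) as [Hnx Hny].
    destruct (second_form S HD Hz Hl) with (u := x) (v := y) as (EL & EM & EM' & EN); auto.
    { intros s t Hst. split; apply Hsp, Hst. }
    rewrite EL, EM in E11, E21. rewrite EM, EN in E12, E22.
    apply (principal_lines (du3 z x y) (dv3 z x y) (l x y) (du3 l x y) (dv3 l x y)
      (f (nu x y)) (g (nu x y)) a1 b1 a2 b2); auto.
    - fold z l in EM, EM'. lra.
    - intros E. destruct (Hfg _ HKn) as [_ Hne]. apply Hne. lra. }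
  destruct (smooth_unit_vector D Wx Wy x0 y0) as (r1 & e1 & Hr1 & HD1 & He1 & P1); auto.
  { apply smooth2_vadd; auto. apply smooth2_vscal; auto. }
  { apply smooth2_vadd; auto. apply smooth2_vscal; auto. }
  { intros x y Hxy. apply Hpt, Hxy. }
  destruct (smooth_unit_vector D Zx Zy x0 y0) as (r2 & e2 & Hr2 & HD2 & He2 & P2); auto.
  { apply smooth2_vadd; auto. apply smooth2_vscal; auto. }
  { apply smooth2_vadd; auto. apply smooth2_vscal; auto. }
  { intros x y Hxy. apply Hpt, Hxy. }
  exists (Rmin r1 r2), e1, e2.
  pose proof (fun q => square_le x0 y0 (Rmin r1 r2) r1 q (Rmin_l r1 r2)) as In1.
  pose proof (fun q => square_le x0 y0 (Rmin r1 r2) r2 q (Rmin_r r1 r2)) as In2.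
  split; [apply Rmin_case; assumption|].
  split; [auto|].
  split; [apply smooth2_R31_restrict with (2 := He1); auto|].
  split; [apply smooth2_R31_restrict with (2 := He2); auto|].
  intros x y Hxy. pose proof (HD1 _ (In1 _ Hxy)) as Dxy.
  destruct (P1 x y (In1 _ Hxy)) as (U1 & C1 & C1' & (s1 & t1 & S1)).
  destruct (P2 x y (In2 _ Hxy)) as (U2 & C2 & C2' & (s2 & t2 & S2)).
  destruct (Hpt x y Dxy) as (_ & _ & O1 & O2 & O3 & O4).
  destruct (Hsp x y Dxy) as (_ & _ & HnX & HnY & _). destruct (Hnl x y Dxy) as [Hnx Hny].
  fold z l in HnX, HnY.
  pose proof (mink_comm (Wx x y) (Zx x y)). pose proof (mink_comm (Wx x y) (Zy x y)).
  pose proof (mink_comm (Wy x y) (Zx x y)). pose proof (mink_comm (Wy x y) (Zy x y)).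
  unfold principal_frame. fold z l.
  change (vadd (du3 l x y) (vscal (f (nu x y)) (du3 z x y))) with (Zx x y).
  change (vadd (dv3 l x y) (vscal (f (nu x y)) (dv3 z x y))) with (Zy x y).
  change (vadd (du3 l x y) (vscal (g (nu x y)) (du3 z x y))) with (Wx x y).
  change (vadd (dv3 l x y) (vscal (g (nu x y)) (dv3 z x y))) with (Wy x y).
  split; [exact U1|]. split; [exact U2|].
  split; [rewrite S1, S2; minks; rewrite O1, O2, O3, O4; ring|].
  split; [rewrite S1; unfold Wx, Wy; minks; rewrite HnX, HnY, Hnx, Hny; ring|].
  split; [rewrite S2; unfold Zx, Zy; minks; rewrite HnX, HnY, Hnx, Hny; ring|].
  split; [rewrite S1; minks; replace (mink (Zx x y) (Wx x y)) with 0 by lra;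
    replace (mink (Zx x y) (Wy x y)) with 0 by lra; ring|].
  split; [rewrite S1; minks; replace (mink (Zy x y) (Wx x y)) with 0 by lra;
    replace (mink (Zy x y) (Wy x y)) with 0 by lra; ring|].
  split; [rewrite S2; minks; rewrite O1, O2; ring|].
  split; [rewrite S2; minks; rewrite O3, O4; ring|].
  auto.
Qed.

(** The first derivatives of a map composed with a change of parameters. *)
Lemma pullback_partials (V U : R * R -> Prop) w a au av b bu bv :
  open U -> smooth2_R31 U w ->
  partials V a au av -> partials V b bu bv ->
  (forall u v, V (u, v) -> U (a u v, b u v)) ->
  forall u v, V (u, v) ->
  du3 (pullback w (fun u v => (a u v, b u v))) u v =
    vadd (vscal (au u v) (du3 w (a u v) (b u v))) (vscal (bu u v) (dv3 w (a u v) (b u v))) /\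
  dv3 (pullback w (fun u v => (a u v, b u v))) u v =
    vadd (vscal (av u v) (du3 w (a u v) (b u v))) (vscal (bv u v) (dv3 w (a u v) (b u v))).
Proof.
  intros HU (H1 & H2 & H3) Ha Hb HVU u v Huv.
  pose proof (smooth2_comp_partials V U _ _ _ _ _ _ _ HU H1 Ha Hb HVU) as E1.
  pose proof (smooth2_comp_partials V U _ _ _ _ _ _ _ HU H2 Ha Hb HVU) as E2.
  pose proof (smooth2_comp_partials V U _ _ _ _ _ _ _ HU H3 Ha Hb HVU) as E3.
  split; apply R31_eq; unfold vadd, vscal, x1, x2, x3; simpl.
  - etransitivity; [exact (partials_du _ _ _ _ u v E1 Huv)|]. unfold du3, dv3, x1; simpl. ring.
  - etransitivity; [exact (partials_du _ _ _ _ u v E2 Huv)|]. unfold du3, dv3, x2; simpl. ring.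
  - etransitivity; [exact (partials_du _ _ _ _ u v E3 Huv)|]. unfold du3, dv3, x3; simpl. ring.
  - etransitivity; [exact (partials_dv _ _ _ _ u v E1 Huv)|]. unfold du3, dv3, x1; simpl. ring.
  - etransitivity; [exact (partials_dv _ _ _ _ u v E2 Huv)|]. unfold du3, dv3, x2; simpl. ring.
  - etransitivity; [exact (partials_dv _ _ _ _ u v E3 Huv)|]. unfold du3, dv3, x3; simpl. ring.
Qed.

Lemma pullback_smooth (V U : R * R -> Prop) w a b :
  open V -> open U -> smooth2_R31 U w -> smooth2 V a -> smooth2 V b ->
  (forall u v, V (u, v) -> U (a u v, b u v)) ->
  smooth2_R31 V (pullback w (fun u v => (a u v, b u v))).
Proof.
  intros HV HU (H1 & H2 & H3) Ha Hb HVU. split; [|split].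
  - exact (smooth2_comp V U _ a b HV HU HVU H1 Ha Hb).
  - exact (smooth2_comp V U _ a b HV HU HVU H2 Ha Hb).
  - exact (smooth2_comp V U _ a b HV HU HVU H3 Ha Hb).
Qed.

(** Parameters whose coordinate vectors are [e1 / alpha] and [e2 / beta], for an
    orthonormal frame, with the normal differentiating to [- k1 e1 / alpha] and
    [- k2 e2 / beta]. *)
Lemma frame_parameters S (k1 k2 alpha beta : R -> R -> R) (e1 e2 : R -> R -> R31) :
  open (dom S) -> smooth2_R31 (dom S) (Defs.pos S) -> smooth2_R31 (dom S) (nrm S) ->
  (forall u v, dom S (u, v) ->
     0 < alpha u v /\ 0 < beta u v /\
     mink (e1 u v) (e1 u v) = 1 /\ mink (e2 u v) (e2 u v) = 1 /\ mink (e1 u v) (e2 u v) = 0 /\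
     mink (nrm S u v) (e1 u v) = 0 /\ mink (nrm S u v) (e2 u v) = 0 /\
     du3 (Defs.pos S) u v = vscal (/ alpha u v) (e1 u v) /\
     dv3 (Defs.pos S) u v = vscal (/ beta u v) (e2 u v) /\
     du3 (nrm S) u v = vscal (- k1 u v / alpha u v) (e1 u v) /\
     dv3 (nrm S) u v = vscal (- k2 u v / beta u v) (e2 u v)) ->
  principal_parameters S /\
  forall u v, dom S (u, v) ->
    cL S u v / cE S u v = k1 u v /\ cN S u v / cG S u v = k2 u v /\
    sqrt (cE S u v) * alpha u v = 1 /\ sqrt (cG S u v) * beta u v = 1.
Proof.
  intros HD Hz Hl Hfr.
  assert (Hall : forall u v, dom S (u, v) -> cF S u v = 0 /\ cM S u v = 0 /\
     cE S u v = / alpha u v * / alpha u v /\ cG S u v = / beta u v * / beta u v /\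
     cL S u v = k1 u v * (/ alpha u v * / alpha u v) /\
     cN S u v = k2 u v * (/ beta u v * / beta u v)).
  { intros u v Huv.
    destruct (second_form S HD Hz Hl) with (u := u) (v := v) as (EL & EM & _ & EN); auto.
    { intros s t Hst. destruct (Hfr s t Hst) as (_ & _ & _ & _ & _ & N1 & N2 & Eu & Ev & _).
      rewrite Eu, Ev. minks. rewrite N1, N2. split; ring. }
    destruct (Hfr u v Huv) as (Ha & Hb & U1 & U2 & U12 & _ & _ & Eu & Ev & Lu & Lv).
    rewrite EL, EM, EN. unfold cE, cF, cG. rewrite Eu, Ev, Lu, Lv. minks.
    rewrite (mink_comm (e2 u v) (e1 u v)), U1, U2, U12.
    repeat split; field; lra. }
  split.
  - intros u v Huv. destruct (Hall u v Huv) as (E & E' & _). auto.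
  - intros u v Huv. destruct (Hall u v Huv) as (_ & _ & EE & EG & EL & EN).
    destruct (Hfr u v Huv) as (Ha & Hb & _).
    pose proof (Rinv_0_lt_compat _ Ha). pose proof (Rinv_0_lt_compat _ Hb).
    rewrite EE, EG, EL, EN. rewrite !sqrt_square by lra.
    repeat split; field; lra.
Qed.

Theorem proposition3p4 :
  forall (S : surface) (K : R -> Prop) (f g : R -> R) (nu : R -> R -> R)
         (nu0 : R),
    weingarten S K f g nu -> K nu0 ->
    forall p : R * R, dom S p ->
    exists (V U : R * R -> Prop) (phi : R -> R -> R * R),
      is_domain V /\ U p /\ (forall q, U q -> dom S q) /\
      diffeo V U phi /\
      natural_principal (reparametrize S V phi) f g (pullback nu phi) nu0.
Proof.
  intros S K f g nu nu0 HS H0 [x0 y0] Hp.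
  destruct (exists_principal_frame S K f g nu x0 y0 HS Hp)
    as (r & e1 & e2 & Hr & HrD & He1 & He2 & Hfr).
  destruct HS as ((HdomS & Hz & Hl & Hsp) & HK & Hf & Hg & Hnu & Hfg & Hpc).
  set (D := square x0 y0 r) in *.
  assert (HD : open D) by apply square_open.
  apply (smooth2_R31_restrict _ D _ HrD) in Hz, Hl.
  apply (smooth2_restrict _ D _ HrD) in Hnu.
  assert (HKD : forall x y, D (x, y) -> K (nu x y)) by (intros; apply Hpc, HrD; assumption).
  assert (Hfg1 : forall t, K t -> f t - g t <> 0) by (intros t Ht; apply Hfg, Ht).
  assert (Hgf1 : forall t, K t -> g t - f t <> 0).
  { intros t Ht E. apply (Hfg1 t Ht). lra. }
  assert (Hkf : smooth2 D (fun x y => f (nu x y))).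
  { apply (smooth2_comp1_n D K f nu 0); auto. }
  assert (Hkg : smooth2 D (fun x y => g (nu x y))).
  { apply (smooth2_comp1_n D K g nu 0); auto. }
  set (I := fun x y => int_I f g nu0 (nu x y)).
  (* [int_J f g] is [int_I g f] by definition *)
  set (J := fun x y => int_I g f nu0 (nu x y)).
  pose proof (int_I_partials D K f g nu nu0 HK Hf Hg Hfg1 H0 Hnu HKD) as HI.
  pose proof (int_I_partials D K g f nu nu0 HK Hg Hf Hgf1 H0 Hnu HKD) as HJ.
  assert (Hquot : forall h k, smooth2 D h -> smooth2 D k ->
     (forall x y, D (x, y) -> k x y <> 0) -> smooth2 D (fun x y => h x y / k x y)).
  { intros h k Hh Hk Hne. apply smooth2_mult; auto. apply smooth2_inv; auto. }
  assert (SI : smooth2 D I).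
  { eapply smooth2_intro; [exact HD | exact HI | |]; apply Hquot;
      auto using smooth2_du, smooth2_dv, smooth2_minus. }
  assert (SJ : smooth2 D J).
  { eapply smooth2_intro; [exact HD | exact HJ | |]; apply Hquot;
      auto using smooth2_du, smooth2_dv, smooth2_minus. }
  set (z := Defs.pos S) in *. set (l := nrm S) in *.
  pose proof (smooth2_du3 _ _ Hz) as Hzx. pose proof (smooth2_dv3 _ _ Hz) as Hzy.
  set (P1 := fun x y => exp (I x y) * mink (du3 z x y) (e1 x y)).
  set (Q1 := fun x y => exp (I x y) * mink (dv3 z x y) (e1 x y)).
  set (P2 := fun x y => exp (J x y) * mink (du3 z x y) (e2 x y)).
  set (Q2 := fun x y => exp (J x y) * mink (dv3 z x y) (e2 x y)).
  assert (SP1 : smooth2 D P1) by (apply smooth2_mult; auto using smooth2_exp, smooth2_mink).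
  assert (SQ1 : smooth2 D Q1) by (apply smooth2_mult; auto using smooth2_exp, smooth2_mink).
  assert (SP2 : smooth2 D P2) by (apply smooth2_mult; auto using smooth2_exp, smooth2_mink).
  assert (SQ2 : smooth2 D Q2) by (apply smooth2_mult; auto using smooth2_exp, smooth2_mink).
  destruct (Poincare_square x0 y0 r P1 Q1 SP1 SQ1) as [s Hs].
  { apply (Codazzi_closed D z l e1 (fun x y => f (nu x y)) (fun x y => g (nu x y)) I); auto.
    intros x y Hxy. destruct (Hfr x y Hxy) as (? & _ & _ & _ & _ & ? & ? & _ & _ & ? & ? & _).
    auto. }
  destruct (Poincare_square x0 y0 r P2 Q2 SP2 SQ2) as [t Ht].
  { apply (Codazzi_closed D z l e2 (fun x y => g (nu x y)) (fun x y => f (nu x y)) J); auto.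
    intros x y Hxy. destruct (Hfr x y Hxy) as (_ & ? & _ & _ & _ & _ & _ & ? & ? & _ & _ & ? & ?).
    auto. }
  (* the coordinate vector fields and the derivatives of the normal in the frame *)
  assert (Hexp : forall x y, D (x, y) ->
     let p1 := mink (du3 z x y) (e1 x y) in let p2 := mink (du3 z x y) (e2 x y) in
     let q1 := mink (dv3 z x y) (e1 x y) in let q2 := mink (dv3 z x y) (e2 x y) in
     du3 z x y = vadd (vscal p1 (e1 x y)) (vscal p2 (e2 x y)) /\
     dv3 z x y = vadd (vscal q1 (e1 x y)) (vscal q2 (e2 x y)) /\
     du3 l x y = vadd (vscal (- f (nu x y) * p1) (e1 x y)) (vscal (- g (nu x y) * p2) (e2 x y)) /\
     dv3 l x y = vadd (vscal (- f (nu x y) * q1) (e1 x y)) (vscal (- g (nu x y) * q2) (e2 x y)) /\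
     p1 * q2 - q1 * p2 <> 0).
  { intros x y Hxy p1 p2 q1 q2.
    destruct (Hfr x y Hxy) as (U1 & U2 & U12 & N1 & N2 & A1 & A2 & A3 & A4 & _).
    destruct (Hsp x y (HrD _ Hxy)) as (Hpd & Hnn & HnX & HnY & _).
    destruct (mink_constant D l l (-1) HD Hl Hl) with (x := x) (y := y) as [L1 L2]; auto.
    { intros a b Hab. apply Hsp, HrD, Hab. }
    rewrite (mink_comm (du3 l x y)) in L1. rewrite (mink_comm (dv3 l x y)) in L2.
    assert (Ex : du3 z x y = vadd (vscal p1 (e1 x y)) (vscal p2 (e2 x y))).
    { apply (frame_expansion (e1 x y) (e2 x y) (l x y)); auto. }
    assert (Ey : dv3 z x y = vadd (vscal q1 (e1 x y)) (vscal q2 (e2 x y))).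
    { apply (frame_expansion (e1 x y) (e2 x y) (l x y)); auto. }
    split; [exact Ex|]. split; [exact Ey|].
    split; [apply (shape_expansion (e1 x y) (e2 x y) (l x y)); auto; lra|].
    split; [apply (shape_expansion (e1 x y) (e2 x y) (l x y)); auto; lra|].
    destruct (posdef_det _ _ _ Hpd) as [_ HG].
    intros Hd. revert HG. unfold cE, cF, cG. fold z.
    replace (mink (du3 z x y) (du3 z x y)) with (p1 * p1 + p2 * p2).
    2:{ rewrite Ex at 2. minks. fold p1 p2. ring. }
    replace (mink (du3 z x y) (dv3 z x y)) with (p1 * q1 + p2 * q2).
    2:{ rewrite Ey at 1. minks. fold p1 p2. ring. }
    replace (mink (dv3 z x y) (dv3 z x y)) with (q1 * q1 + q2 * q2).
    2:{ rewrite Ey at 2. minks. fold q1 q2. ring. }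
    replace (_ - _) with ((p1 * q2 - q1 * p2) ^ 2) by ring. rewrite Hd. lra. }
  destruct (inverse_function D s t P1 Q1 P2 Q2 x0 y0) as
    (V & U & a & b & HVdom & HU0 & HUD & Hdiff & Ha & Hb); auto.
  { apply square_center, Hr. }
  { intros x y Hxy. destruct (Hexp x y Hxy) as (_ & _ & _ & _ & Hne).
    unfold P1, Q1, P2, Q2. replace (_ - _) with (exp (I x y) * exp (J x y) *
      (mink (du3 z x y) (e1 x y) * mink (dv3 z x y) (e2 x y) -
       mink (dv3 z x y) (e1 x y) * mink (du3 z x y) (e2 x y))) by ring.
    pose proof (exp_pos (I x y)). pose proof (exp_pos (J x y)).
    repeat apply Rmult_integral_contrapositive_currified; auto; lra. }
  exists V, U, (fun u v => (a u v, b u v)).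
  split; [exact HVdom|]. split; [exact HU0|]. split; [intros q Hq; apply HrD, HUD, Hq|].
  split; [exact Hdiff|].
  destruct Hdiff as (HV & HU & [Sa Sb] & HVU & _). simpl in Sa, Sb.
  assert (HVD : forall u v, V (u, v) -> D (a u v, b u v)) by (intros; apply HUD, HVU; assumption).
  destruct (frame_parameters (reparametrize S V (fun u v => (a u v, b u v)))
    (pullback (fun x y => f (nu x y)) (fun u v => (a u v, b u v)))
    (pullback (fun x y => g (nu x y)) (fun u v => (a u v, b u v)))
    (pullback (fun x y => exp (I x y)) (fun u v => (a u v, b u v)))
    (pullback (fun x y => exp (J x y)) (fun u v => (a u v, b u v)))
    (pullback e1 (fun u v => (a u v, b u v)))
    (pullback e2 (fun u v => (a u v, b u v)))) as [Hpp Hnat].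
  - exact HV.
  - apply pullback_smooth with D; auto.
  - apply pullback_smooth with D; auto.
  - intros u v Huv. simpl in Huv. pose proof (HVD u v Huv) as Dab.
    destruct (pullback_partials V D z _ _ _ _ _ _ HD Hz Ha Hb HVD u v Huv) as [Eu Ev].
    destruct (pullback_partials V D l _ _ _ _ _ _ HD Hl Ha Hb HVD u v Huv) as [Lu Lv].
    simpl. fold z l. rewrite Eu, Ev, Lu, Lv. unfold pullback; simpl.
    clear Eu Ev Lu Lv.
    set (x := a u v) in *. set (y := b u v) in *.
    destruct (Hfr x y Dab) as (U1 & U2 & U12 & N1 & N2 & _). fold l in N1, N2.
    destruct (Hexp x y Dab) as (Ex & Ey & Lx & Ly & Hne).
    split; [apply exp_pos|]. split; [apply exp_pos|].
    split; [exact U1|]. split; [exact U2|]. split; [exact U12|].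
    split; [exact N1|]. split; [exact N2|].
    rewrite Lx, Ly. unfold P1, P2, Q1, Q2.
    revert Ex Ey Hne.
    generalize (mink (du3 z x y) (e1 x y)) as p1, (mink (du3 z x y) (e2 x y)) as p2,
      (mink (dv3 z x y) (e1 x y)) as q1, (mink (dv3 z x y) (e2 x y)) as q2.
    intros p1 p2 q1 q2 Ex Ey Hne. rewrite Ex, Ey.
    pose proof (exp_pos (I x y)). pose proof (exp_pos (J x y)).
    assert (Hd : exp (I x y) * p1 * (exp (J x y) * q2) - exp (I x y) * q1 * (exp (J x y) * p2) <> 0).
    { replace (_ - _) with (exp (I x y) * exp (J x y) * (p1 * q2 - q1 * p2)) by ring.
      repeat apply Rmult_integral_contrapositive_currified; auto; lra. }
    repeat split; apply R31_eq; unfold vadd, vscal, x1, x2, x3; simpl; field;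
      repeat split; auto; lra.
  - split; [exact Hpp|]. split; [|split].
    + intros u v Huv. destruct (Hnat u v Huv) as (? & ? & _). auto.
    + exists 1. intros u v Huv. apply (Hnat u v Huv).
    + exists 1. intros u v Huv. apply (Hnat u v Huv).
Qed.
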